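(* Let $R$ be a ring, let $\mathcal{X}$ be a class of right $R$-modules closed under isomorphisms, and let $M$ be a right $R$-module with an epimorphic $\mathcal{X}$-cover $p:X\to M$ such that $\mathrm{End}(X)/J(\mathrm{End}(X))$ is a von Neumann regular right self-injective ring and idempotents lift modulo $J(\mathrm{End}(X))$. Let $M$ be $\mathcal{X}$-automorphism-coinvariant and assume that every direct summand of $M$ has an $\mathcal{X}$-cover. Assume further that for $\mathcal{X}$-endomorphism-coinvariant modules, the finite exchange property implies the full exchange property. Then $M$ satisfies the full exchange property.
   Context: Rings are associative with identity, modules are unital right modules, $J(-)$ is the Jacobson radical. An $\mathcal{X}$-precover of $M$ is a homomorphism $p:X\to M$ with $X\in\mathcal{X}$ such that every homomorphism $X'\to M$ with $X'\in\mathcal{X}$ factors through $p$. It is an $\mathcal{X}$-cover if, moreover, every endomorphism $h$ of $X$ with $p\circ h=p$ is an automorphism; it is epimorphic if $p$ is an epimorphism. $M$ is $\mathcal{X}$-automorphism-coinvariant (resp. $\mathcal{X}$-endomorphism-coinvariant) if there is an $\mathcal{X}$-cover $p:X\to M$ such that for every automorphism (resp. endomorphism) $g$ of $X$ there is an endomorphism $f$ of $M$ with $f\circ p=p\circ g$. A right $R$-module $M$ has the (full) exchange property if for every right $R$-module $A$ and any two direct sum decompositions $A=M'\oplus N=\bigoplus_{i\in I}A_i$ with $M'\cong M$ there are submodules $B_i\subseteq A_i$ with $A=M'\oplus\bigl(\bigoplus_{i\in I}B_i\bigr)$; it has the finite exchange property if this holds for all finite index sets $I$. *)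

(* Defs.v *)
From HB Require Import structures.
From mathcomp Require Import all_boot all_algebra generic_quotient.
From mathcomp Require Import boolp classical_sets cardinality fsbigop.

Set Implicit Arguments.
Unset Strict Implicit.
Unset Printing Implicit Defensive.

Import GRing.Theory.

Local Open Scope classical_set_scope.
Local Open Scope quotient_scope.
Local Open Scope ring_scope.

(* MathComp modules are left modules, so a right R-module is a left module
   over the converse ring: [r *: x] for [r : R^c] is the right action [x r].
   The module notions below are stated for [lmodType K] with an arbitrary
   ring K, and are meant to be used at [K := R^c].  [pzRingType] does not
   exclude the zero ring; this is needed for the endomorphism ring of the
   zero module. *)
Notation rmodType R := (GRing.Lmodule.type R^c).

Definition isomorphic (K : pzRingType) (U V : lmodType K) : Prop :=
  exists f : {linear U -> V}, bijective f.

Definition iso_closed (K : pzRingType) (C : lmodType K -> Prop) : Prop :=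
  forall U V : lmodType K, isomorphic U V -> C U -> C V.

Definition injective_module (K : pzRingType) (E : lmodType K) : Prop :=
  forall (A B : lmodType K) (i : {linear A -> B}) (f : {linear A -> E}),
    injective i -> exists g : {linear B -> E}, g \o i =1 f.

(* Membership is boolean, which is no restriction under the classical axioms
   of [boolp]: any subset S of A has the membership test [fun x => `[< S x >]]. *)
Notation submodule := submodClosed.

Definition module_of (K : pzRingType) (A : lmodType K) (S : submodule A) :
  Type := {x : A | x \in S}.
HB.instance Definition _ (K : pzRingType) (A : lmodType K)
  (S : submodule A) := SubChoice.on (module_of S).
HB.instance Definition _ (K : pzRingType) (A : lmodType K)
  (S : submodule A) := [SubChoice_isSubLmodule of module_of S by <:].

(* A is the internal direct sum of the family S: every element of A is in
   exactly one way a sum of a finitely supported family of elements of the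
   S i.  [\sum_(i \in setT) f i] is only the intended sum when f has finite
   support, whence the explicit condition. *)
Definition direct_sum (K : pzRingType) (A : lmodType K) (I : choiceType)
    (S : I -> submodule A) : Prop :=
  forall a : A, exists! f : I -> A,
    [/\ forall i, f i \in S i,
        finite_set [set i | f i != 0] &
        a = \sum_(i \in [set: I]) f i].

(* A = U (+) V *)
Definition direct_sum2 (K : pzRingType) (A : lmodType K) (U V : submodule A) :
  Prop := direct_sum (fun b : bool => if b then U else V).

(* A = U (+) ((+)_i S i) *)
Definition direct_sum_cons (K : pzRingType) (A : lmodType K) (U : submodule A)
    (I : choiceType) (S : I -> submodule A) : Prop :=
  direct_sum (fun o : option I => if o is Some i then S i else U).

Definition direct_summand (K : pzRingType) (A : lmodType K)
  (U : submodule A) : Prop := exists V : submodule A, direct_sum2 U V.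

Definition exchange_property_for (K : pzRingType) (I : choiceType)
    (M : lmodType K) : Prop :=
  forall (A : lmodType K) (M' N : submodule A) (S : I -> submodule A),
    isomorphic (module_of M') M ->
    direct_sum2 M' N ->
    direct_sum S ->
    exists B : I -> submodule A,
      (forall i, {subset B i <= S i}) /\ direct_sum_cons M' B.

(* Index sets are choiceTypes: under the classical axioms of [boolp] every
   type carries such a structure. *)
Definition full_exchange (K : pzRingType) (M : lmodType K) : Prop :=
  forall I : choiceType, exchange_property_for I M.

Definition finite_exchange (K : pzRingType) (M : lmodType K) : Prop :=
  forall I : finType, exchange_property_for I M.

Definition is_precover (K : pzRingType) (C : lmodType K -> Prop)
    (X M : lmodType K) (p : {linear X -> M}) : Prop :=
  C X /\ forall (X' : lmodType K) (q : {linear X' -> M}),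
    C X' -> exists h : {linear X' -> X}, p \o h =1 q.

Definition is_cover (K : pzRingType) (C : lmodType K -> Prop)
    (X M : lmodType K) (p : {linear X -> M}) : Prop :=
  is_precover C p /\ forall h : {linear X -> X}, p \o h =1 p -> bijective h.

Definition has_cover (K : pzRingType) (C : lmodType K -> Prop)
  (M : lmodType K) : Prop :=
  exists (X : lmodType K) (p : {linear X -> M}), is_cover C p.

Definition epimorphic (K : pzRingType) (X M : lmodType K)
  (p : {linear X -> M}) : Prop := forall m : M, exists x : X, p x = m.

Definition automorphism_coinvariant (K : pzRingType)
    (C : lmodType K -> Prop) (M : lmodType K) : Prop :=
  exists (X : lmodType K) (p : {linear X -> M}), is_cover C p /\
    forall g : {linear X -> X}, bijective g ->
      exists f : {linear M -> M}, f \o p =1 p \o g.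

Definition endomorphism_coinvariant (K : pzRingType)
    (C : lmodType K -> Prop) (M : lmodType K) : Prop :=
  exists (X : lmodType K) (p : {linear X -> M}), is_cover C p /\
    forall g : {linear X -> X},
      exists f : {linear M -> M}, f \o p =1 p \o g.

(* Endomorphisms are written on the left, opposite to the scalars of a right
   module: the product of f and g is [f \o g]. *)
Section EndomorphismRing.
Variables (K : pzRingType) (U : lmodType K).

Definition End : Type := {linear U -> U}.

HB.instance Definition _ := gen_eqMixin End.
HB.instance Definition _ := gen_choiceMixin End.

Implicit Types f g h : End.

Lemma End_ext f g : (f : U -> U) =1 g -> f = g.
Proof.
move=> /funext; case: f g => [f [[fA] [fZ]]] [g [[gA] [gZ]]] /= e.
case: g / e gA gZ => gA gZ.
by rewrite (Prop_irrelevance fA gA) (Prop_irrelevance fZ gZ).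
Qed.

Definition End_zero : End := \0 : {linear U -> U}.
Definition End_opp f : End := \- (f : {linear U -> U}).
Definition End_add f g : End :=
  (f : {linear U -> U}) \+ (g : {linear U -> U}).
Definition End_one : End := idfun : {linear U -> U}.
Definition End_mul f g : End :=
  (f : {linear U -> U}) \o (g : {linear U -> U}).

Lemma End_addA : associative End_add.
Proof. by move=> f g h; apply: End_ext => x; rewrite /= addrA. Qed.
Lemma End_addC : commutative End_add.
Proof. by move=> f g; apply: End_ext => x; rewrite /= addrC. Qed.
Lemma End_add0 : left_id End_zero End_add.
Proof. by move=> f; apply: End_ext => x; rewrite /= add0r. Qed.
Lemma End_addN : left_inverse End_zero End_opp End_add.
Proof. by move=> f; apply: End_ext => x; rewrite /= addNr. Qed.
Lemma End_mulA : associative End_mul.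
Proof. by move=> f g h; apply: End_ext. Qed.
Lemma End_mul1f : left_id End_one End_mul.
Proof. by move=> f; apply: End_ext. Qed.
Lemma End_mulf1 : right_id End_one End_mul.
Proof. by move=> f; apply: End_ext. Qed.
Lemma End_mulDl : left_distributive End_mul End_add.
Proof. by move=> f g h; apply: End_ext. Qed.
Lemma End_mulDr : right_distributive End_mul End_add.
Proof. by move=> f g h; apply: End_ext => x; rewrite /= raddfD. Qed.

HB.instance Definition _ := GRing.isPzRing.Build End
  End_addA End_addC End_add0 End_addN End_mulA End_mul1f End_mulf1
  End_mulDl End_mulDr.
End EndomorphismRing.

Definition right_ideal (S : pzRingType) (I : set S) : Prop :=
  [/\ I 0, forall x y, I x -> I y -> I (x - y) & forall x r, I x -> I (x * r)].

Definition maximal_right_ideal (S : pzRingType) (I : set S) : Prop :=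
  [/\ right_ideal I, I != setT &
      forall L, right_ideal L -> L != setT -> I `<=` L -> L = I].

Definition jacobson (S : pzRingType) : set S :=
  [set a | forall I, maximal_right_ideal I -> I a].

Section JacobsonQuotient.
Variable S : pzRingType.
Notation J := (@jacobson S).
Implicit Types (a b x y r : S) (I : set S).

Lemma right_idealN I x : right_ideal I -> I x -> I (- x).
Proof. by move=> [I0 IB _] Ix; rewrite -sub0r; apply: IB. Qed.

Lemma right_idealD I x y : right_ideal I -> I x -> I y -> I (x + y).
Proof.
move=> rI Ix Iy; rewrite -[y]opprK; case: (rI) => _ IB _.
by apply: IB => //; apply: right_idealN.
Qed.

Lemma right_ideal1 I : right_ideal I -> I 1 -> I = setT.
Proof.
by move=> [_ _ IM] I1; apply/seteqP; split=> // x _; rewrite -[x]mul1r; apply: IM.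
Qed.

Lemma jacobson_right_ideal : right_ideal J.
Proof.
split=> [I [[]]//|x y Jx Jy I mI|x r Jx I mI]; case: (mI) => -[_ IB IM] _ _.
- by apply: IB; [apply: Jx | apply: Jy].
- by apply: IM; apply: Jx.
Qed.

(* For I maximal and r not in I, [set x | I (r * x)] is the annihilator of a
   generator of the simple module S / I, hence again maximal. *)
Lemma maximal_right_ideal_colon I r : maximal_right_ideal I -> ~ I r ->
  maximal_right_ideal [set x | I (r * x)].
Proof.
move=> [rI _ maxI] Ir; case: (rI) => I0 IB IM.
have rC : right_ideal [set x | I (r * x)].
  split=> /= [|x y Ix Iy|x s Ix]; first by rewrite mulr0.
    by rewrite mulrBr; apply: IB.
  by rewrite mulrA; apply: IM.
split=> //.
  apply/eqP => /seteqP[_ /(_ 1)] /=; rewrite mulr1 => H; exact/Ir/H.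
move=> L rL LT CL; apply/seteqP; split=> // x Lx /=.
case: (rL) => L0 LB LM.
pose P := [set z | exists y l, [/\ I y, L l & z = y + r * l]].
have rP : right_ideal P.
  split=> [|z w [y [l [Iy Ll ->]]] [y' [l' [Iy' Ll' ->]]]|z s [y [l [Iy Ll ->]]]].
  - by exists 0, 0; split=> //; rewrite mulr0 addr0.
  - exists (y - y'), (l - l'); split; [exact: IB | exact: LB |].
    by rewrite mulrBr opprD addrACA.
  - exists (y * s), (l * s); split; [exact: IM | exact: LM |].
    by rewrite mulrDl mulrA.
have IP : I `<=` P by move=> y Iy; exists y, 0; split=> //; rewrite mulr0 addr0.
case: (eqVneq P setT) => [PT|PT].
  have [y [l [Iy Ll e]]] : P r by rewrite PT.
  exfalso; move/eqP: LT; apply; apply: right_ideal1 => //.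
  rewrite -(subrK l 1); apply: right_idealD => //; apply: CL => /=.
  by rewrite mulrBr mulr1 {1}e addrK.
rewrite -(maxI P rP PT IP); exists 0, x; split=> //; by rewrite add0r.
Qed.

Lemma jacobson_mull a r : J a -> J (r * a).
Proof.
move=> Ja I mI; case: (pselect (I r)) => Ir.
  by case: mI => -[_ _ IM] _ _; apply: IM.
exact: (Ja _ (maximal_right_ideal_colon mI Ir)).
Qed.

Definition jacobson_eq x y : bool := `[< J (x - y) >].

Lemma jacobson_eq_equiv : equiv_class_of jacobson_eq.
Proof.
have rJ := jacobson_right_ideal.
split=> [x|x y|y x z]; rewrite /jacobson_eq.
- by apply/asboolP; rewrite subrr; case: rJ.
- by apply: asbool_equiv_eq; split=> /(right_idealN rJ); rewrite opprB.
- move=> /asboolP Jxy /asboolP Jyz; apply/asboolP.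
  by rewrite -(subrK y x) -addrA; apply: (right_idealD rJ).
Qed.

Canonical jacobson_equiv_rel := EquivRelPack jacobson_eq_equiv.

(* S / J(S) *)
Definition jacobson_quot : Type := {eq_quot jacobson_eq}.

HB.instance Definition _ := Choice.on jacobson_quot.
HB.instance Definition _ := EqQuotient.on jacobson_quot.

Notation Q := jacobson_quot.
Definition jacobson_pi (x : S) : Q := \pi x.
Notation pi := jacobson_pi.

Lemma jacobson_quot_eqP x y : (pi x = pi y) <-> J (x - y).
Proof.
by split=> [/eqmodP/asboolP|Jxy]; last by apply/eqmodP/asboolP.
Qed.

Lemma jacobson_reprK x : J (x - repr (pi x)).
Proof. by apply/jacobson_quot_eqP; rewrite /jacobson_pi reprK. Qed.

Lemma jacobson_pi_surj (u : Q) : exists x, u = pi x.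
Proof. by exists (repr u); rewrite /jacobson_pi reprK. Qed.

Definition jacobson_quot_opp (u : Q) : Q := pi (- repr u).
Definition jacobson_quot_add (u v : Q) : Q := pi (repr u + repr v).
Definition jacobson_quot_mul (u v : Q) : Q := pi (repr u * repr v).

Lemma jacobson_quot_oppE x : jacobson_quot_opp (pi x) = pi (- x).
Proof.
by apply/jacobson_quot_eqP; rewrite opprK addrC; apply: jacobson_reprK.
Qed.

Lemma jacobson_quot_addE x y : jacobson_quot_add (pi x) (pi y) = pi (x + y).
Proof.
apply/esym/jacobson_quot_eqP; rewrite opprD addrACA.
by apply: (right_idealD jacobson_right_ideal); apply: jacobson_reprK.
Qed.

Lemma jacobson_quot_mulE x y : jacobson_quot_mul (pi x) (pi y) = pi (x * y).
Proof.
apply/esym/jacobson_quot_eqP.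
rewrite -(subrK (x * repr (pi y)) (x * y)) -addrA -mulrBr -mulrBl.
have [_ _ JM] := jacobson_right_ideal.
by apply: (right_idealD jacobson_right_ideal);
  [apply: jacobson_mull | apply: JM]; apply: jacobson_reprK.
Qed.

Let QE := (jacobson_quot_oppE, jacobson_quot_addE, jacobson_quot_mulE).

Opaque jacobson_quot_opp jacobson_quot_add jacobson_quot_mul.

Lemma jacobson_quot_addA : associative jacobson_quot_add.
Proof.
by move=> /jacobson_pi_surj[x ->] /jacobson_pi_surj[y ->] /jacobson_pi_surj[z ->];
  rewrite !QE addrA.
Qed.
Lemma jacobson_quot_addC : commutative jacobson_quot_add.
Proof.
by move=> /jacobson_pi_surj[x ->] /jacobson_pi_surj[y ->];
  rewrite !QE addrC.
Qed.
Lemma jacobson_quot_add0 : left_id (pi 0) jacobson_quot_add.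
Proof.
by move=> /jacobson_pi_surj[x ->];
  rewrite !QE add0r.
Qed.
Lemma jacobson_quot_addN :
  left_inverse (pi 0) jacobson_quot_opp jacobson_quot_add.
Proof.
by move=> /jacobson_pi_surj[x ->];
  rewrite !QE addNr.
Qed.
Lemma jacobson_quot_mulA : associative jacobson_quot_mul.
Proof.
by move=> /jacobson_pi_surj[x ->] /jacobson_pi_surj[y ->] /jacobson_pi_surj[z ->];
  rewrite !QE mulrA.
Qed.
Lemma jacobson_quot_mul1x : left_id (pi 1) jacobson_quot_mul.
Proof.
by move=> /jacobson_pi_surj[x ->];
  rewrite !QE mul1r.
Qed.
Lemma jacobson_quot_mulx1 : right_id (pi 1) jacobson_quot_mul.
Proof.
by move=> /jacobson_pi_surj[x ->];
  rewrite !QE mulr1.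
Qed.
Lemma jacobson_quot_mulDl :
  left_distributive jacobson_quot_mul jacobson_quot_add.
Proof.
by move=> /jacobson_pi_surj[x ->] /jacobson_pi_surj[y ->] /jacobson_pi_surj[z ->];
  rewrite !QE mulrDl.
Qed.
Lemma jacobson_quot_mulDr :
  right_distributive jacobson_quot_mul jacobson_quot_add.
Proof.
by move=> /jacobson_pi_surj[x ->] /jacobson_pi_surj[y ->] /jacobson_pi_surj[z ->];
  rewrite !QE mulrDr.
Qed.

Transparent jacobson_quot_opp jacobson_quot_add jacobson_quot_mul.

HB.instance Definition _ := GRing.isPzRing.Build jacobson_quot
  jacobson_quot_addA jacobson_quot_addC jacobson_quot_add0 jacobson_quot_addN
  jacobson_quot_mulA jacobson_quot_mul1x jacobson_quot_mulx1
  jacobson_quot_mulDl jacobson_quot_mulDr.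
End JacobsonQuotient.

Definition von_neumann_regular (S : pzRingType) : Prop :=
  forall a : S, exists x : S, a = a * x * a.

(* [S^c^o] is S as a right S-module: [r *: x = x * r] with the product of S. *)
Definition right_self_injective (S : pzRingType) : Prop :=
  injective_module (S^c^o : rmodType S).

Definition idempotents_lift_mod_jacobson (S : pzRingType) : Prop :=
  forall a : S, jacobson (a * a - a) ->
    exists e : S, e * e = e /\ jacobson (e - a).

(* Main.v *)
From HB Require Import structures.
Require Import Defs.
From mathcomp Require Import all_boot all_algebra.
From mathcomp Require Import boolp classical_sets cardinality fsbigop wochoice.

(* Let S = End X and let J be its radical.  Covers make J contain every s with
   p s = 0, so f |-> s + J for f p = p s is a ring morphism rho : End M -> S/J;
   coinvariance says that its image contains the units of S/J.  A maximal
   partial monomorphism of S/J with image disjoint from its domain yields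
   orthogonal isomorphic idempotents e, e' of S/J such that d = e + e' has
   complement g = 1 - d with g (S/J) g abelian.  Every element of d (S/J) d is a
   sum of products of square-zero elements, hence lies in the image of rho.
   Lifting d to an idempotent of End M splits M as N (+) L.  Then N is
   endomorphism-coinvariant with the finite exchange property, whereas
   End L is abelian regular modulo a quasi-regular ideal, for which full
   exchange is shown directly: a summable family with sum 1 is made orthogonal
   modulo the ideal by transfinite recursion, and the images of the resulting
   idempotents are independent by a Nakayama-type elimination. *)

Set Implicit Arguments.
Unset Strict Implicit.
Unset Printing Implicit Defensive.

Import GRing.Theory.

Local Open Scope classical_set_scope.
Local Open Scope ring_scope.

(** Automorphisms alone give little: a product of copies of the field with two elements is regular
    and self-injective, yet its only unit is 1. So [rho] need not be onto, and d isolates what units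
    generate. Since e and e' are isomorphic, d (S/J) d is a ring of 2 by 2 matrices over e (S/J) e,
    whose diagonal entries are sums of products of off-diagonal ones. No such room is left in g
    (S/J) g, but there every element differs from a unit by an idempotent; this keeps the relevant
    part of the image of [rho] closed under suitable quasi-inverses even where it is a proper
    subring. Nothing makes L endomorphism-coinvariant, so the assumed implication gives nothing for
    L. The infinite sums needed for its full exchange exist only pointwise in End L and have no
    counterpart in S/J; congruences pass through them by evaluation at single vectors, where only
    finitely many terms matter. *)

Lemma Zorn_above T (P : set (set T)) (A0 : set T) :
  P A0 ->
  (forall F : set (set T), F !=set0 -> F `<=` P -> total_on F subset ->
     P (\bigcup_(A in F) A)) ->
  exists A, [/\ P A, A0 `<=` A & forall B, P B -> A `<=` B -> B `<=` A].
Proof.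
move=> PA0 Pchain.
(* [Zorn_bigcup] also asks about the empty chain; for the property that the union of [A] and [A0]
   satisfies [P], that case is just [P A0]. *)
have [F FP Ftot|A [PA maxA]] := @Zorn_bigcup T [set A | P (A `|` A0)].
  rewrite /mkset; case: (pselect (F !=set0)) => [[B FB]|F0].
    have -> : \bigcup_(A in F) A `|` A0 = \bigcup_(A in [set A `|` A0 | A in F]) A.
      rewrite bigcup_image predeqE => x; split=> [[[A FA Ax]|A0x]|[A FA [Ax|A0x]]].
      - by exists A => //; left.
      - by exists B => //; right.
      - by left; exists A.
      - by right.
    apply: Pchain => [|_ [A FA <-]|_ _ [A FA <-] [A' FA' <-]].
    - by exists (B `|` A0), B.
    - exact: FP.
    - by case: (Ftot _ _ FA FA') => AA'; [left|right]; apply: setSU.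
  have -> : \bigcup_(A in F) A `|` A0 = A0; last by [].
  by rewrite predeqE => x; split=> [[[A FA]|//]|]; [case: F0; exists A | right].
exists (A `|` A0); split=> //.
move=> B PB AB.
have AsB : A `<=` B by move=> x Ax; apply: AB; left.
have A0B : A0 `<=` B by move=> x Ax; apply: AB; right.
case: (pselect (B `<=` A)) => [BA x /BA|nBA]; first by left.
case: (maxA B); first by split.
by rewrite /= setUidl.
Qed.

(** * Submodules, linear maps and injectivity in terms of predicates *)

Section SubmoduleOf.
Variables (K : pzRingType) (A : lmodType K).

Definition is_submodule (P : set A) : Prop :=
  [/\ P 0, forall x y, P x -> P y -> P (x - y) & forall a x, P x -> P (a *: x)].

Lemma is_submodule_closed (P : set A) :
  is_submodule P -> submod_closed (fun x => `[< P x >]).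
Proof.
move=> [P0 PB PZ].
have PD x y : P x -> P y -> P (x + y).
  by move=> Px Py; rewrite -[y]opprK; apply: (PB); rewrite // -sub0r; apply: (PB).
split=> [|a x y /asboolP Px /asboolP Py]; apply/asboolP => //.
by apply: PD; first exact: PZ.
Qed.

Definition submodule_of (P : set A) (subP : is_submodule P) : submodule A :=
  HB.pack_for (submodClosed A) (fun x => `[< P x >])
    (GRing.isSubmodClosed.Build K A (fun x => `[< P x >]) (is_submodule_closed subP)).

Lemma in_submodule_of (P : set A) (subP : is_submodule P) x :
  (x \in submodule_of subP) <-> P x.
Proof. by split=> /asboolP. Qed.

End SubmoduleOf.

Definition linear_of (K : pzRingType) (U V : lmodType K) (f : U -> V)
    (flin : linear f) : {linear U -> V} :=
  HB.pack_for {linear U -> V} f (GRing.isLinear.Build _ _ _ _ f flin).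

(** A homomorphism from a right ideal into Q is given by its graph [D]. Injectivity extends the
    second projection of [D] along the first to an endomorphism of Q as a right module, which is
    left multiplication by its value at 1. *)
Lemma right_self_injectiveP (Q : pzRingType) (D : set (Q * Q)) :
  right_self_injective Q ->
  D (0, 0) ->
  (forall x y x' y', D (x, y) -> D (x', y') -> D (x - x', y - y')) ->
  (forall x y r, D (x, y) -> D (x * r, y * r)) ->
  (forall y, D (0, y) -> y = 0) ->
  exists a, forall x y, D (x, y) -> y = a * x.
Proof.
move=> Qinj D0 DB DM Dfun.
pose W : lmodType Q^c := (Q^c^o * Q^c^o)%type.
have DB' (u v : W) : D u -> D v -> D (u - v).
  by case: u v => [x y] [x' y']; apply: DB.
have DZ' (r : Q^c) (u : W) : D u -> D (r *: u).
  by case: u => [x y]; apply: DM.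
have subD : @is_submodule _ W D by [].
pose S := submodule_of subD.
pose i (u : module_of S) : Q^c^o := (val u).1.
pose f (u : module_of S) : Q^c^o := (val u).2.
have ilin : linear i by [].
have flin : linear f by [].
pose I := linear_of ilin; pose G := linear_of flin.
have Iinj : injective I.
  move=> [[x y] /= Dxy] [[x' y'] /= Dxy'] exx; apply: val_inj => /=.
  have {}exx : x = x' := exx.
  have := DB _ _ _ _ ((in_submodule_of subD _).1 Dxy) ((in_submodule_of subD _).1 Dxy').
  by rewrite exx subrr => /Dfun /eqP; rewrite subr_eq0 => /eqP ->.
have [g gI] := Qinj _ _ I G Iinj.
exists (g 1) => x y Dxy.
have Sxy : ((x, y) : W) \in S by apply/in_submodule_of.
have <- : g x = y := gI (@exist W (fun z => z \in S) (x, y) Sxy).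
transitivity (g ((x : Q^c) *: (1 : Q^c^o))); last exact: linearZ_LR.
congr (g _); exact/esym/(mul1r x).
Qed.

(** * Regular right self-injective rings *)

(** A right ideal kQ is represented by its membership predicate. Intersecting it with the right
    annihilator of v stays in this class: with w a quasi-inverse of vk, the idempotent n = wvk has
    the same right annihilator as vk, and k - kn generates the intersection. *)
Lemma regular_annihilatorI (Q : pzRingType) (P : Q -> Prop) (k v : Q) :
  von_neumann_regular Q -> k * k = k -> (forall x, P x <-> k * x = x) ->
  exists e, e * e = e /\ forall x, P x /\ v * x = 0 <-> e * x = x.
Proof.
move=> Qreg kk Pk; have [w vkw] := Qreg (v * k).
have [n [nE nk vkn nn]] : exists n,
    [/\ n = w * (v * k), n * k = n, v * k * n = v * k & n * n = n].
  exists (w * (v * k)); split=> //; first by rewrite -!mulrA kk.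
    by rewrite mulrA -vkw.
  by rewrite -mulrA (mulrA _ w) -vkw.
exists (k - k * n); split.
  rewrite mulrBl !mulrBr !mulrA kk -(mulrA k n k) nk -(mulrA k n n) nn.
  by rewrite subrr subr0.
move=> x; split=> [[/Pk kx vx]|<-].
  by rewrite mulrBl kx nE -!mulrA kx vx !mulr0 subr0.
split; first by apply/Pk; rewrite !mulrA mulrBr !mulrA kk.
by rewrite mulrA mulrBr !mulrA vkn subrr mul0r.
Qed.

Section SquareFreeComplement.
Variable Q : pzRingType.

(* Graphs of monomorphisms from a right ideal A into Q whose image meets A
   trivially *)
Definition disjoint_mono_graph (D : set (Q * Q)) : Prop :=
  [/\ forall x y x' y', D (x, y) -> D (x', y') -> D (x - x', y - y'),
      forall x y r, D (x, y) -> D (x * r, y * r),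
      forall x y, D (x, y) -> (x = 0 <-> y = 0) &
      forall x y x', D (x, y) -> D (x', x) -> x = 0].

Lemma disjoint_mono_graph_max : exists D,
  [/\ disjoint_mono_graph D, D (0, 0) &
      forall D', disjoint_mono_graph D' -> D `<=` D' -> D' `<=` D].
Proof.
have [|F [A0 FA0] Fgood Ftot|D [goodD D0 maxD]] :=
    @Zorn_above _ disjoint_mono_graph [set (0, 0)].
- split=> [x y x' y' [-> ->] [-> ->]|x y r [-> ->]|x y [-> ->]|x y x' [-> _] _] //.
    by rewrite subrr.
  by rewrite !mul0r.
- have common u v : (\bigcup_(A in F) A) u -> (\bigcup_(A in F) A) v ->
      exists A, [/\ F A, A u & A v].
    move=> [A FA Au] [B FB Bv]; have [AB|BA] := Ftot _ _ FA FB.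
      by exists B; split=> //; apply: AB.
    by exists A; split=> //; apply: BA.
  split=> [x y x' y' Du Dv|x y r [A FA Au]|x y [A FA Au]|x y x' Du Dv].
  + have [A [FA Au Av]] := common _ _ Du Dv; exists A => //.
    by have [AB _ _ _] := Fgood A FA; apply: AB.
  + by exists A => //; have [_ AM _ _] := Fgood A FA; apply: AM.
  + by have [_ _ A1 _] := Fgood A FA; apply: A1.
  + have [A [FA Au Av]] := common _ _ Du Dv.
    by have [_ _ _ A2] := Fgood A FA; apply: A2 Au Av.
- by exists D; split=> //; apply: D0.
Qed.

Hypotheses (Qreg : von_neumann_regular Q) (Qinj : right_self_injective Q).

(** Left multiplications by c1 and c2 are mutually inverse isomorphisms between eQ and c1 c2 Q. They
    come from a maximal [D] by injectivity: maximality makes its domain generated by an idempotent,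
    and a nonzero k q (1 - d - k) would allow a proper extension of [D]. *)
Lemma square_free_complement : exists e c1 c2 : Q,
  [/\ e * e = e, [/\ e * c1 = 0, c1 * e = c1, e * c2 = c2 & c2 * e = 0],
      c2 * c1 = e &
      let d := e + c1 * c2 in
      forall k q, k * k = k -> d * k = 0 -> k * d = 0 ->
        k * q * (1 - d - k) = 0].
Proof.
have [D [[DB DM Dmono Ddisj] D0 maxD]] := disjoint_mono_graph_max.
have [|a Da] := right_self_injectiveP Qinj D0 DB DM.
  by move=> y Dy; apply/(Dmono _ _ Dy).
have [||||a' Da'] := @right_self_injectiveP Q [set u | D (u.2, u.1)] Qinj => //=.
- by move=> x y x' y' Dx Dx'; apply: DB.
- by move=> x y r Dx; apply: DM.
- by move=> y Dy; apply/(Dmono _ _ Dy).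
(* [b] extends the projection of dom D + im D onto dom D with kernel im D; disjointness makes it
   well defined. *)
have [||||b Db] := @right_self_injectiveP Q
    [set u | exists w x' y', [/\ D (u.2, w), D (x', y') & u.1 = u.2 + y']] Qinj => /=.
- by exists 0, 0, 0; rewrite addr0.
- move=> _ v _ v' [w [x [y [Dv Dx ->]]]] [w' [x' [y' [Dv' Dx' ->]]]].
  exists (w - w'), (x - x'), (y - y'); split; [exact: DB..|].
  by rewrite opprD addrACA.
- move=> _ v r [w [x [y [Dv Dx ->]]]]; exists (w * r), (x * r), (y * r).
  by rewrite mulrDl; split=> //; apply: DM.
- move=> v [w [x [y [Dv Dx /esym/eqP]]]]; rewrite addr_eq0 => /eqP vy.
  apply: (Ddisj _ _ (- x)) Dv _.
  by have := DB _ _ _ _ D0 Dx; rewrite !sub0r vy.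
have bx x y : D (x, y) -> b * x = x.
  by move=> Dx; apply/esym/Db => /=; exists y, 0, 0; rewrite addr0.
have by0 x y : D (x, y) -> b * y = 0.
  by move=> Dx; apply/esym/Db => /=; exists 0, x, y; rewrite add0r.
(* Three conditions that hold on dom D and together make left multiplication by [a] injective with
   image disjoint from its source. They cut out e0 Q, so maximality gives dom D = e0 Q. *)
have [e1 [e11 Pe1]] := @regular_annihilatorI Q (fun=> True) 1 (a' * a - 1) Qreg
  (mulr1 1) (fun x => conj (fun=> mul1r x) (fun=> I)).
have [e2 [e22 Pe2]] := regular_annihilatorI (b - 1) Qreg e11 Pe1.
have [e0 [e00 Pe0]] := regular_annihilatorI (b * a) Qreg e22 Pe2.
have {e1 e11 Pe1 e2 e22 Pe2} Pe x :
    [/\ a' * a * x = x, b * x = x & b * a * x = 0] <-> e0 * x = x.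
  rewrite -Pe0 !mulrBl !mul1r; split=> [[-> -> ->]|]; first by rewrite subrr.
  by move=> [[[_ /eqP]]]; rewrite subr_eq0 => /eqP-> /eqP; rewrite subr_eq0 => /eqP ->.
have De x y : D (x, y) -> e0 * x = x.
  move=> Dx; apply/Pe; split; [|exact: bx Dx|].
    by rewrite -mulrA -(Da _ _ Dx) -(Da' y x).
  by rewrite -mulrA -(Da _ _ Dx) (by0 _ _ Dx).
have eD x : e0 * x = x -> D (x, a * x).
  move=> ex; apply: (maxD [set u | e0 * u.1 = u.1 /\ u.2 = a * u.1]) => //=.
    split=> /= [u v u' v' [eu ->] [eu' ->]|u v r [eu ->]|u v [eu ->]
               |u v w [eu _] [ew uE]].
    - by rewrite !mulrBr eu eu'.
    - by rewrite !mulrA eu.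
    - split=> [->|au]; first by rewrite mulr0.
      by have [<- _ _] := (Pe u).2 eu; rewrite -mulrA au mulr0.
    - by have [_ _ bw] := (Pe w).2 ew; have [_ <- _] := (Pe u).2 eu; rewrite uE mulrA.
  by move=> [u v] Du /=; split; [apply: De Du | apply: Da].
have [aae be bae] := (Pe e0).2 e00.
(* [e] generates the same right ideal as [e0] but, thanks to [b], also kills [a * e0]. The factor 1
   - e in c2 makes c2 e vanish. *)
have [e [c1 [c2 [eE c1E c2E]]]] : exists e c1 c2,
  [/\ e = e0 * b, c1 = a * e & c2 = e * a' * (1 - e)] by do 3!eexists.
have ee : e * e = e by rewrite eE mulrA -(mulrA e0) be e00.
have ee0 : e * e0 = e0 by rewrite eE -mulrA be e00.
have e0e : e0 * e = e by rewrite eE mulrA e00.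
have ec1 : e * c1 = 0.
  have -> : e * c1 = e0 * (b * a * e0) * b by rewrite c1E eE !mulrA.
  by rewrite bae mulr0 mul0r.
have c1e : c1 * e = c1 by rewrite c1E -mulrA ee.
have ec2 : e * c2 = c2 by rewrite c2E !mulrA ee.
have c2e : c2 * e = 0 by rewrite c2E -mulrA mulrBl mul1r ee subrr mulr0.
have c21 : c2 * c1 = e.
  rewrite c2E -mulrA mulrBl mul1r ec1 subr0 c1E -mulrA (mulrA a') -e0e.
  by rewrite (mulrA (a' * a)) aae e0e ee.
exists e, c1, c2; split=> // k q kk; set d := e + c1 * c2 => dk kd.
have [m mE] : exists m, m = 1 - d - k by eexists.
rewrite -mE; have [t tE] : exists t, t = k * q * m by eexists.
have eD' x : e * x = x -> D (x, c1 * x).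
  by move=> ex; rewrite c1E -mulrA ex; apply: eD; rewrite -ex mulrA e0e.
have ed : e * d = e by rewrite /d mulrDr ee mulrA ec1 mul0r addr0.
have fd : c1 * c2 * d = c1 * c2.
  by rewrite /d mulrDr -!mulrA c2e mulr0 add0r (mulrA c2) c21 ec2.
have dd : d * d = d by rewrite {1}/d mulrDl ed fd.
have ek : e * k = 0 by rewrite -ed -mulrA dk mulr0.
have fk : c1 * c2 * k = 0 by rewrite -fd -mulrA dk mulr0.
have kc1 : k * c1 = 0.
  have df : d * (c1 * c2) = c1 * c2.
    by rewrite /d mulrDl mulrA ec1 mul0r add0r -mulrA (mulrA c2) c21 ec2.
  have kf : k * (c1 * c2) = 0 by rewrite -df mulrA kd mul0r.
  by rewrite -c1e -c21 !mulrA -(mulrA k) kf mul0r.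
have [t' tt't] := Qreg t.
have km : k * m = 0 by rewrite mE !mulrBr mulr1 kd kk subr0 subrr.
have mm : m * m = m.
  rewrite {1}mE !mulrBl mul1r km subr0 mE !mulrBr mulr1 dd dk.
  by rewrite subr0 subrr subr0.
have em : e * m = 0 by rewrite mE !mulrBr mulr1 ed ek subrr subr0.
have fm : c1 * c2 * m = 0 by rewrite mE !mulrBr mulr1 fd fk subrr subr0.
have kt : k * t = t by rewrite tE !mulrA kk.
have tm : t * m = t by rewrite tE -mulrA mm.
have [h [hE mh th hh]] : exists h,
    [/\ h = m * t' * t, m * h = h, t * h = t & h * h = h].
  exists (m * t' * t); split=> //; first by rewrite !mulrA mm.
    by rewrite !mulrA tm -tt't.
  by rewrite -!mulrA (mulrA t) tm (mulrA t) -tt't.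
have eh : e * h = 0 by rewrite -mh mulrA em mul0r.
have fh : c1 * c2 * h = 0 by rewrite -mh mulrA fm mul0r.
have kh : k * h = 0 by rewrite -mh mulrA km mul0r.
have et : e * t = 0 by rewrite -kt mulrA ek mul0r.
have ft : c1 * c2 * t = 0 by rewrite -kt mulrA fk mul0r.
have c2t : c2 * t = 0 by rewrite -ec2 -c21 -!mulrA (mulrA c1) ft mulr0.
have fc1 : c1 * c2 * c1 = c1 by rewrite -mulrA c21.
(* Left multiplication by [t] is injective on hQ, with hQ inside mQ and tQ inside kQ, so [D] extends
   by h r -> t r. Maximality then puts [h] into eQ, while e h = 0; hence h = 0 and t = t h = 0. *)
pose D' := [set u : Q * Q | exists x r,
  [/\ e * x = x, u.1 = x + h * r & u.2 = c1 * x + t * r]].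
have goodD' : disjoint_mono_graph D'.
  split=> [_ _ _ _ [x [r [/= ex -> ->]]] [x' [r' [/= ex' -> ->]]]|||].
  - exists (x - x'), (r - r'); rewrite /= !mulrBr ex ex'.
    by split=> //; rewrite opprD addrACA.
  - move=> _ _ s [x [r [/= ex -> ->]]]; exists (x * s), (r * s).
    by rewrite /= !mulrDl !mulrA ex.
  - move=> _ _ [x [r [/= ex -> ->]]]; split=> eq0.
      have x0 : x = 0.
        by have := congr1 ( *%R e) eq0; rewrite mulrDr ex mulrA eh mul0r addr0 mulr0.
      move: eq0; rewrite x0 add0r mulr0 add0r -th -mulrA => ->.
      by rewrite mulr0.
    have x0 : x = 0.
      have := congr1 ( *%R c2) eq0.
      by rewrite mulrDr !mulrA c21 ex c2t mul0r addr0 mulr0.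
    move: eq0; rewrite x0 mulr0 !add0r => tr0.
    by rewrite hE -mulrA tr0 mulr0.
  - move=> u _ _ [x [r [/= ex uE _]]] [x' [r' [/= ex' _ uE']]].
    have x0 : x = 0.
      have : e * u = x by rewrite uE mulrDr ex mulrA eh mul0r addr0.
      by move=> <-; rewrite uE' mulrDr !mulrA ec1 et !mul0r addr0.
    have tr0 : t * r' = 0.
      have : k * u = t * r' by rewrite uE' mulrDr !mulrA kc1 kt mul0r add0r.
      by move=> <-; rewrite uE x0 add0r mulrA kh mul0r.
    have : c1 * c2 * u = u by rewrite uE' tr0 addr0 mulrA fc1.
    by move=> <-; rewrite uE x0 add0r mulrA fh mul0r.
have /De he : D (h, t).
  apply: (maxD D' goodD'); last first.
    by exists 0, 1; rewrite /= !mulr0 !mulr1 !add0r.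
  move=> [x y] Dxy; exists x, 0 => /=; rewrite !mulr0 !addr0.
  have ex : e * x = x by rewrite -(De _ _ Dxy) mulrA ee0.
  by split=> //; rewrite c1E -mulrA ex; apply: Da.
by rewrite -tE -th -he -ee0 -mulrA he eh mulr0.
Qed.

End SquareFreeComplement.

(** * Subrings that contain all units *)

Definition subring_with_units (Q : pzRingType) (T : set Q) : Prop :=
  [/\ forall u v, u * v = 1 -> v * u = 1 -> T u,
      forall x y, T x -> T y -> T (x - y) &
      forall x y, T x -> T y -> T (x * y)].

Section SubringWithUnits.
Variables (Q : pzRingType) (T : set Q).
Hypothesis unitT : subring_with_units T.

Lemma subring_with_units1 : T 1.
Proof. by case: unitT => T1 _ _; apply: (T1 1 1); rewrite mulr1. Qed.

Lemma subring_with_unitsD x y : T x -> T y -> T (x + y).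
Proof.
case: unitT => _ TB _ Tx Ty; rewrite -[y]opprK; apply: (TB) => //.
by rewrite -sub0r; apply: (TB) => //; rewrite -(subrr y); apply: (TB).
Qed.

Lemma subring_with_units_square0 n : n * n = 0 -> T n.
Proof.
case: unitT => TU TB _ nn.
rewrite -(addKr 1 n) addrC; apply: TB subring_with_units1.
apply: (TU _ (1 - n)); first by rewrite mulrBr mulr1 mulrDl mul1r nn addr0 addrK.
by rewrite mulrBl mul1r mulrDr mulr1 nn addr0 addrK.
Qed.

(* Each of the four blocks is square-zero or a product of two square-zero
   elements, and these are units minus 1. *)
Lemma subring_with_units_corner (e c1 c2 : Q) :
  e * c1 = 0 -> c1 * e = c1 -> e * c2 = c2 -> c2 * e = 0 -> c2 * c1 = e ->
  forall q, T ((e + c1 * c2) * q * (e + c1 * c2)).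
Proof.
case: unitT => _ _ TM ec1 c1e ec2 c2e c21 q.
have c11 : c1 * c1 = 0 by rewrite -{1}c1e -mulrA ec1 mulr0.
have c22 : c2 * c2 = 0 by rewrite -{2}ec2 mulrA c2e mul0r.
have sq a b : b * a = 0 -> T (a * q * b).
  move=> ba; apply: subring_with_units_square0.
  by rewrite -mulrA [b * _]mulrA [b * _]mulrA ba !mul0r mulr0.
have Tc1 : T c1 by apply: subring_with_units_square0.
have Tc2 : T c2 by apply: subring_with_units_square0.
rewrite !mulrDl !mulrDr; do !apply: subring_with_unitsD.
- by rewrite -{1}c21 -!mulrA (mulrA c1 q); apply: TM => //; apply: sq.
- by apply: sq; rewrite -mulrA c2e mulr0.
- by apply: sq; rewrite mulrA ec1 mul0r.
- by rewrite -!mulrA (mulrA c2 q); apply: TM => //; apply: sq; rewrite -mulrA c22 mulr0.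
Qed.

End SubringWithUnits.

Section AbelianCorner.
Variables (Q : pzRingType) (g : Q).

(* The idempotents of g Q g are central in g Q g. *)
Definition abelian_corner : Prop := forall k q,
  k * k = k -> g * k = k -> k * g = k -> k * q * (g - k) = 0.

Hypotheses (gg : g * g = g) (gab : abelian_corner).

Lemma abelian_cornerC k q :
  k * k = k -> g * k = k -> k * g = k -> g * q = q -> q * g = q -> k * q = q * k.
Proof.
move=> kk gk kg gq qg.
have := gab q kk gk kg; rewrite mulrBr -mulrA qg => /eqP; rewrite subr_eq0 => /eqP ->.
have := @gab (g - k) q; rewrite subKr !mulrBl !mulrBr gg gk kg kk gq subrr subr0.
by move=> /(_ erefl erefl erefl) /eqP; rewrite subr_eq0 => /eqP.
Qed.

(** The point is to find y inside [T]. In an abelian corner the idempotent h = q y commutes with q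
    and y and equals y q, so q + (1 - h) is a unit with inverse y h + (1 - h). Both lie in [T],
    hence so do 1 - h and y h. *)
Lemma abelian_corner_quasi_inverse (T : set Q) q :
  von_neumann_regular Q -> subring_with_units T ->
  g * q = q -> q * g = q -> T q -> exists y, T y /\ q = q * y * q.
Proof.
move=> Qreg unitT gq qg Tq.
have [y [gy yg qyq]] : exists y, [/\ g * y = y, y * g = y & q * y * q = q].
  have [y0 qy0] := Qreg q; exists (g * y0 * g); split.
  - by rewrite !mulrA gg.
  - by rewrite -mulrA gg.
  - by rewrite !mulrA qg -mulrA gq -qy0.
have [h [hE hh gh hg]] : exists h, [/\ h = q * y, h * h = h, g * h = h & h * g = h].
  exists (q * y); split=> //; first by rewrite mulrA qyq.
    by rewrite mulrA gq.
  by rewrite -mulrA yg.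
have hq : h * q = q by rewrite hE.
have qh : q * h = q by rewrite -(abelian_cornerC hh gh hg gq qg).
have yh : y * h = h * y by rewrite (abelian_cornerC hh gh hg gy yg).
have yq : y * q = h.
  have h'h' : (y * q) * (y * q) = y * q by rewrite -mulrA (mulrA q) qyq.
  have gh' : g * (y * q) = y * q by rewrite mulrA gy.
  have h'g : (y * q) * g = y * q by rewrite -mulrA qg.
  have h'q : y * q * q = q.
    by rewrite (abelian_cornerC h'h' gh' h'g gq qg) mulrA qyq.
  by rewrite -{1}qh mulrA {1}hE mulrA h'q hE.
case: unitT => TU TB _.
have h'h' : (1 - h) * (1 - h) = 1 - h.
  by rewrite mulrBr mulr1 mulrBl mul1r hh subrr subr0.
have h'q : (1 - h) * q = 0 by rewrite mulrBl mul1r hq subrr.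
have qh' : q * (1 - h) = 0 by rewrite mulrBr mulr1 qh subrr.
have h'yh : (1 - h) * (y * h) = 0.
  by rewrite mulrBl mul1r mulrA -yh -mulrA hh subrr.
have yhh' : y * h * (1 - h) = 0 by rewrite -mulrA mulrBr mulr1 hh subrr mulr0.
have uv : (q + (1 - h)) * (y * h + (1 - h)) = 1.
  rewrite mulrDl (mulrDr q) (mulrDr (1 - h)) qh' h'yh h'h' addr0 add0r.
  by rewrite mulrA -hE hh addrC subrK.
have vu : (y * h + (1 - h)) * (q + (1 - h)) = 1.
  rewrite mulrDl (mulrDr (y * h)) (mulrDr (1 - h)) yhh' h'q h'h' addr0 add0r.
  by rewrite -mulrA hq yq addrC subrK.
have T1h : T (1 - h).
  by rewrite -(addrK q (1 - h)) [1 - h + q]addrC; apply: TB => //; apply: TU uv vu.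
exists (y * h); split; last by rewrite !mulrA -hE hh hq.
by rewrite -(addrK (1 - h) (y * h)); apply: TB => //; apply: TU vu uv.
Qed.
End AbelianCorner.

(** * Direct sums as families of projectors *)

Section FiniteSupportSums.
Variables (I : choiceType) (V : zmodType).
Implicit Types F G : I -> V.

Definition finsupp F : Prop := finite_set [set i | F i != 0].

Lemma seq_finsupp F (s : seq I) : (forall i, F i != 0 -> i \in s) -> finsupp F.
Proof. by move=> Fs; apply: sub_finite_set (finite_seq s) => i; apply: Fs. Qed.

Lemma finsupp_seq F : finsupp F ->
  exists s : seq I, uniq s /\ forall i, F i != 0 -> i \in s.
Proof.
move=> /finite_seqP[s /seteqP[sF _]]; exists (undup s).
by split=> [|i Fi]; [exact: undup_uniq | rewrite mem_undup; apply: sF].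
Qed.

Lemma finsupp_seq2 F G : finsupp F -> finsupp G ->
  exists s : seq I, [/\ uniq s, forall i, F i != 0 -> i \in s &
                        forall i, G i != 0 -> i \in s].
Proof.
move=> /finsupp_seq[s [_ Fs]] /finsupp_seq[t [_ Gt]]; exists (undup (s ++ t)).
by split=> [|i /Fs si|i /Gt ti]; rewrite ?undup_uniq // mem_undup mem_cat ?si ?ti ?orbT.
Qed.

Lemma finsuppD F G : finsupp F -> finsupp G -> finsupp (fun i => F i + G i).
Proof.
move=> finF finG; have [s [us Fs Gs]] := finsupp_seq2 finF finG.
apply: (seq_finsupp (s := s)) => i FGi; case: (eqVneq (F i) 0) => [Fi|/Fs//].
by apply: Gs; move: FGi; rewrite Fi add0r.
Qed.

Lemma fsum_seq F (s : seq I) : uniq s -> (forall i, F i != 0 -> i \in s) ->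
  \sum_(i \in [set: I]) F i = \sum_(i <- s) F i.
Proof.
move=> us Fs; rewrite (fsbigE s) //.
  by apply: eq_bigl => i; rewrite in_setT.
by move=> i _; apply: contraNeq => /Fs.
Qed.

Lemma fsum1 F i0 : (forall i, i != i0 -> F i = 0) ->
  \sum_(i \in [set: I]) F i = F i0.
Proof.
move=> F0; rewrite (fsum_seq (s := [:: i0])) // ?big_seq1 // => i.
by rewrite inE; apply: contraNT => /F0 ->.
Qed.

Lemma fsumD F G : finsupp F -> finsupp G ->
  \sum_(i \in [set: I]) (F i + G i) =
  \sum_(i \in [set: I]) F i + \sum_(i \in [set: I]) G i.
Proof.
move=> finF finG; have [s [us Fs Gs]] := finsupp_seq2 finF finG.
rewrite !(fsum_seq us) // ?big_split // => i FGi.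
case: (eqVneq (F i) 0) => [Fi|/Fs//].
by apply: Gs; move: FGi; rewrite Fi add0r.
Qed.

End FiniteSupportSums.

Lemma finsupp_subset (I : choiceType) (V W : zmodType) (F : I -> V) (G : I -> W) :
  finsupp F -> (forall i, F i = 0 -> G i = 0) -> finsupp G.
Proof.
move=> finF FG; apply: sub_finite_set finF => i /=.
by apply: contraNN => /eqP/FG ->.
Qed.

Lemma fsum_raddf (I : choiceType) (U V : zmodType) (f : {additive U -> V})
    (F : I -> U) : finsupp F ->
  f (\sum_(i \in [set: I]) F i) = \sum_(i \in [set: I]) f (F i).
Proof.
move=> /finsupp_seq[s [us Fs]]; rewrite !(fsum_seq us) ?raddf_sum //.
by move=> i fFi; apply: Fs; apply: contraNneq fFi => ->; rewrite raddf0.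
Qed.

Lemma fsum_linear (I : choiceType) (K : pzRingType) (U V : lmodType K)
    (f : {linear U -> V}) (F : I -> U) : finsupp F ->
  f (\sum_(i \in [set: I]) F i) = \sum_(i \in [set: I]) f (F i).
Proof. exact: fsum_raddf. Qed.

Lemma fsum_option (I : choiceType) (V : zmodType) (F : option I -> V) :
  finsupp (fun i => F (Some i)) ->
  finsupp F /\
  \sum_(o \in [set: option I]) F o = F None + \sum_(i \in [set: I]) F (Some i).
Proof.
move=> /finsupp_seq[s [us Fs]].
have Fs' o : F o != 0 -> o \in None :: map some s.
  by case: o => // i /Fs si; rewrite inE /= mem_map // => ? ? [].
have us' : uniq (None :: map some s).
  rewrite /= map_inj_uniq => [|? ? []//]; rewrite us andbT.
  by apply/mapP => -[].
split; last by rewrite (fsum_seq us' Fs') big_cons big_map (fsum_seq us Fs).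
exact: seq_finsupp Fs'.
Qed.

Lemma fsum_bool (V : zmodType) (F : bool -> V) :
  \sum_(b \in [set: bool]) F b = F true + F false.
Proof.
rewrite (fsum_seq (s := [:: true; false])) //; last by case.
by rewrite big_cons big_seq1.
Qed.

Section Projectors.
Variables (K : pzRingType) (A : lmodType K) (I : choiceType).

Definition projectors (e : I -> {linear A -> A}) : Prop :=
  [/\ forall i a, e i (e i a) = e i a,
      forall i j a, i != j -> e i (e j a) = 0,
      forall a, finsupp (e^~ a) &
      forall a, a = \sum_(i \in [set: I]) e i a].

Lemma projectors_direct_sum (S : I -> submodule A) e :
  projectors e -> (forall i a, a \in S i <-> e i a = a) -> direct_sum S.
Proof.
move=> [eK e0 efin esum] Se a; exists (e^~ a); split.
  split; [by move=> i; apply/Se | exact: efin | exact: esum].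
move=> f [Sf finf af]; apply/funext => i.
rewrite af fsum_linear // (fsum1 (i0 := i)); first by apply/Se.
by move=> j ji; rewrite -((Se _ _).1 (Sf j)) e0 // eq_sym.
Qed.

Lemma direct_sum_projectors (S : I -> submodule A) : direct_sum S ->
  exists e, projectors e /\ forall i a, a \in S i <-> e i a = a.
Proof.
move=> dS; have /choice[f fP] a := dS a.
have fE a g : (forall i, g i \in S i) -> finsupp g ->
    a = \sum_(i \in [set: I]) g i -> f a = g.
  by move=> Sg fing ag; have [_] := fP a; apply.
have Sf a i : f a i \in S i by have [[]] := fP a.
have ffin a : finsupp (f a) by have [[]] := fP a.
have fsum a : a = \sum_(i \in [set: I]) f a i by have [[]] := fP a.
have flin i : linear (fun a => f a i).
  move=> k a b.
  have kfin : finsupp (fun j => k *: f a j).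
    by apply: finsupp_subset (ffin a) _ => j ->; rewrite scaler0.
  rewrite (fE (k *: a + b) (fun j => k *: f a j + f b j)) //.
  - by move=> j; rewrite rpredD ?rpredZ.
  - exact: finsuppD.
  rewrite fsumD // -fsum; congr (_ + _).
  by rewrite {1}(fsum a) fsum_raddf.
exists (fun i => linear_of (flin i)).
have f_single i a : a \in S i -> f a = fun j => if j == i then a else 0.
  move=> Sa; apply: fE => [j||].
  - by case: eqP => [->|_] //; rewrite rpred0.
  - apply: (seq_finsupp (s := [:: i])) => j; rewrite inE.
    by case: (j == i); rewrite ?eqxx.
  - by rewrite (fsum1 (i0 := i)) ?eqxx // => j /negbTE ->.
have feE i a : a \in S i <-> f a i = a.
  split=> [Sa|<-]; last exact: Sf.
  by rewrite (f_single i a Sa) eqxx.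
split; last exact: feE.
split=> [i a|i j a ij|a|a] //=; first exact/feE.
by rewrite (f_single j) // (negbTE ij).
Qed.

End Projectors.

Lemma linear_inverse (K : pzRingType) (U V : lmodType K) (f : {linear U -> V}) :
  bijective f -> exists g : {linear V -> U}, cancel f g /\ cancel g f.
Proof.
move=> [g fg gf]; have glin : linear g.
  by move=> k u v; apply: (can_inj fg); rewrite gf linearP !gf.
by exists (linear_of glin).
Qed.

Lemma submodule_incl (K : pzRingType) (A : lmodType K) (S : submodule A) :
  exists i : {linear module_of S -> A}, forall s, i s = \val s.
Proof.
have vlin : linear (\val : module_of S -> A) by [].
by exists (linear_of vlin).
Qed.

Section ExchangeOperators.
Variable K : pzRingType.
Implicit Types A M : lmodType K.

(* phi is a projection of A onto the image of iota whose kernel is the direct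
   sum of its intersections with the e i A. *)
Definition exchange_operators (I : choiceType) M : Prop :=
  forall A (e : I -> {linear A -> A}) (iota : {linear M -> A})
    (pi : {linear A -> M}),
  projectors e -> cancel iota pi ->
  exists phi : {linear A -> M}, cancel iota phi /\
    forall i a, phi a = 0 -> phi (e i a) = 0.

Lemma is_submodule_fix A (f : {linear A -> A}) : is_submodule [set a | f a = a].
Proof.
split=> [|x y /= fx fy|k x /= fx] /=; first exact: linear0.
  by rewrite linearB fx fy.
by rewrite linearZ /= fx.
Qed.

Lemma is_submodule_ker A M (f : {linear A -> M}) : is_submodule [set a | f a = 0].
Proof.
split=> [|x y /= fx fy|k x /= fx] /=; first exact: linear0.
  by rewrite linearB fx fy subrr.
by rewrite linearZ /= fx scaler0.
Qed.

Lemma projectors2 A (f g : {linear A -> A}) :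
  (forall a, f (f a) = f a) -> (forall a, g a = a - f a) ->
  projectors (fun b : bool => if b then f else g).
Proof.
move=> ff gE; split=> [[] a|[] [] a //|a|a]; rewrite /= ?gE //.
- by rewrite linearB /= ff subrr subr0.
- by rewrite linearB /= ff subrr.
- by rewrite ff subrr.
- by apply: (seq_finsupp (s := [:: true; false])) => -[].
- by rewrite fsum_bool gE addrC subrK.
Qed.

(** In one direction phi is [pi] after the projection onto M' along the sum of the B i; for a vector
    of its kernel the components in the B i and in the S i coincide. Conversely, B i is the
    intersection of S i with the kernel of phi. *)
Lemma exchange_operatorsP (I : choiceType) M :
  exchange_property_for I M <-> exchange_operators I M.
Proof.
split=> [exM A e iota pi eP iotaK|exM A M' N S [theta thetaB] dMN dS].
  pose S i := submodule_of (is_submodule_fix (e i)).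
  have ef : forall a, (iota \o pi) ((iota \o pi) a) = (iota \o pi) a.
    by move=> a /=; rewrite iotaK.
  pose M' := submodule_of (is_submodule_fix (iota \o pi)).
  pose N := submodule_of (is_submodule_ker pi).
  have M'E a : a \in M' <-> iota (pi a) = a by exact: in_submodule_of.
  have NE a : a \in N <-> pi a = 0 by exact: in_submodule_of.
  have SE i a : a \in S i <-> e i a = a by exact: in_submodule_of.
  have [v vE] := submodule_incl M'.
  have M'M : isomorphic (module_of M') M.
    have iotaM m : iota m \in M' by apply/M'E; rewrite iotaK.
    exists (pi \o v); exists (fun m => Sub (iota m) (iotaM m)) => [x|m] /=.
      by apply: val_inj; rewrite SubK vE; apply/M'E/(valP x).
    by rewrite vE SubK iotaK.
  have dMN : direct_sum2 M' N.
    apply: projectors_direct_sum (projectors2 ef (g := idfun \- (iota \o pi)) _) _ => //.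
    case=> a; first exact: in_submodule_of.
    split=> [/NE pia|/= <-]; first by rewrite /= pia linear0 subr0.
    by apply/NE; rewrite /= linearB /= iotaK subrr.
  have dS : direct_sum S.
    exact: projectors_direct_sum eP SE.
  have [B [BS /direct_sum_projectors[E [EP BE]]]] := exM A M' N S M'M dMN dS.
  have [EK E0 Efin Esum] := EP; have [eK e0 efin esum] := eP.
  exists (pi \o E None); split=> [m|i a] /=.
    by rewrite (BE None _).1 ?iotaK //; apply/M'E; rewrite iotaK.
  move=> piE; have Ea : E None a = 0.
    have /M'E : E None a \in M' by apply/(BE None).
    by rewrite piE linear0.
  have EB j : E (Some j) a \in B j by apply/(BE (Some j)).
  have eE j : e j (E (Some j) a) = E (Some j) a by apply/SE/BS/EB.
  have -> : e i a = E (Some i) a.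
    rewrite {1}(Esum a).
    rewrite fsum_linear // (fsum1 (i0 := Some i)) ?eE // => -[j|] ji.
      by rewrite -eE e0 //; apply: contraNneq ji => ->.
    by rewrite Ea linear0.
  by rewrite E0 ?linear0.
have [e [eP eS]] := direct_sum_projectors dS.
have [f [fP fM]] := direct_sum_projectors dMN.
have [eK e0 efin esum] := eP; have [fK f0 _ fsum] := fP.
have [theta' [thetaK theta'K]] := linear_inverse thetaB.
have [v vE] := submodule_incl M'.
have fM' a : f true a \in M' by apply/(fM true).
have plin : linear (fun a => Sub (f true a) (fM' a) : module_of M').
  by move=> k a b; apply: val_inj; rewrite /= linearP.
have [iota iotaE] : exists iota : {linear M -> A}, forall m, iota m = v (theta' m).
  by exists (v \o theta').
have [pi piE] : exists pi : {linear A -> M},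
    forall a, pi a = theta (Sub (f true a) (fM' a)).
  by exists (theta \o linear_of plin).
have iotaM m : f true (iota m) = iota m.
  by apply/(fM true); rewrite iotaE vE; apply: valP.
have iotaK : cancel iota pi.
  move=> m; rewrite piE -[RHS]theta'K; congr (theta _); apply: val_inj.
  by rewrite SubK iotaM iotaE vE.
have [phi [phiK phie]] := exM A e iota pi eP iotaK.
have subB i : is_submodule [set a | e i a = a /\ phi a = 0].
  have [? eB eZ] := is_submodule_fix (e i); have [? phiB phiZ] := is_submodule_ker phi.
  split=> [|x y [ex phix] [ey phiy]|k x [ex phix]]; first by split.
    by split; [apply: eB | apply: phiB].
  by split; [apply: eZ | apply: phiZ].
exists (fun i => submodule_of (subB i)); split.
  by move=> i a /in_submodule_of[ea _]; apply/eS.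
pose E (o : option I) : {linear A -> A} :=
  if o is Some i then e i \o (idfun \- (iota \o phi)) else iota \o phi.
have phiB a : phi (a - iota (phi a)) = 0 by rewrite linearB /= phiK subrr.
have eB i a : e i (a - iota (phi a)) - iota (phi (e i (a - iota (phi a)))) =
    e i (a - iota (phi a)) by rewrite (phie _ _ (phiB a)) linear0 subr0.
have Efin a : finsupp (fun i => E (Some i) a) by exact: efin.
apply: (@projectors_direct_sum _ _ _ _ E).
  split=> [[i|] a|[i|] [j|] a //= ij|a|a]; rewrite /= ?phiK //.
  - by rewrite eB eK.
  - by rewrite eB e0 //; apply: contraNneq ij => ->.
  - by rewrite subrr linear0.
  - by rewrite phie // linear0.
  - by have [] := @fsum_option I A (E^~ a) (Efin a).
  - have [_ ->] := @fsum_option I A (E^~ a) (Efin a).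
    by rewrite /= -esum addrC subrK.
case=> [i|] a.
  split=> [/in_submodule_of[ea phia]|/= <-].
    by rewrite /= phia linear0 subr0.
  by apply/(in_submodule_of (subB i)); split; [exact: eK | exact: phie].
split=> [/(fM true) fa|/= <-]; last first.
  by apply/(fM true); apply: iotaM.
have <- : iota (pi a) = a; last by rewrite /= phiK.
by rewrite iotaE piE vE thetaK SubK.
Qed.
End ExchangeOperators.

(** * Exchange rings and finite exchange *)

Lemma fsum_is_linear (I : choiceType) (K : pzRingType) (U V : lmodType K)
    (c : I -> {linear U -> V}) : (forall u, finsupp (c^~ u)) ->
  linear (fun u => \sum_(i \in [set: I]) c i u).
Proof.
move=> cfin k u v.
have kfin : finsupp (fun i => k *: c i u).
  by apply: finsupp_subset (cfin u) _ => i ->; rewrite scaler0.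
rewrite fsum_raddf // -fsumD //.
by congr (\big[_/_]_(i \in _) _); apply/funext => i; rewrite linearP.
Qed.

Section ExchangeFromFamily.
Variables (K : pzRingType) (A M : lmodType K) (I : choiceType).
Variables (e : I -> {linear A -> A}) (iota : {linear M -> A})
  (pi : {linear A -> M}) (z : I -> {linear M -> M}) (v : {linear M -> M}).

(** Take phi = v o (sum of z i o pi o e i). If phi a = 0, independence kills each term z i (pi (e i
    a)), and phi (e i a) is [v] of exactly that term. *)
Lemma exchange_from_family :
  projectors e ->
  (forall m, v (\sum_(i \in [set: I]) z i (pi (e i (iota m)))) = m) ->
  (forall a, \sum_(i \in [set: I]) z i (pi (e i a)) = 0 ->
     forall i, z i (pi (e i a)) = 0) ->
  injective v ->
  exists phi : {linear A -> M}, cancel iota phi /\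
    forall i a, phi a = 0 -> phi (e i a) = 0.
Proof.
move=> [eK e0 efin _] vz zind vinj.
have zfin a : finsupp (fun i => z i (pi (e i a))).
  by apply: finsupp_subset (efin a) _ => i ->; rewrite !linear0.
have zlin := @fsum_is_linear I K A M (fun i => z i \o (pi \o e i)) zfin.
exists (v \o linear_of zlin); split=> [m|i a] /=; first exact: vz.
move=> va0; have /zind za0 : \sum_(j \in [set: I]) z j (pi (e j a)) = 0.
  by apply: vinj; apply: etrans va0 (esym (linear0 v)).
rewrite (fsum1 (i0 := i)) ?eK ?za0 ?linear0 // => j ji.
by rewrite e0 // !linear0.
Qed.

End ExchangeFromFamily.

(* Nicholson's condition; for endomorphism rings it is the finite exchange
   property. *)
Definition exchange_ring (E : pzRingType) : Prop := forall x : E, exists s r,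
  s * x * (s * x) = s * x /\ 1 - s * x = r * (1 - x).

Section ExchangeRing.
Variable E : pzRingType.
Hypothesis exE : exchange_ring E.

Lemma exchange_ring_corner (u x : E) : u * u = u -> u * x = x -> x * u = x ->
  exists e s r, [/\ e * e = e, u * e = e, e * u = e, e = s * x & u - e = r * (u - x)].
Proof.
move=> uu ux xu; have [s [r [ee e1]]] := exE x.
have eu : s * x * u = s * x by rewrite -mulrA xu.
exists (u * (s * x)), (u * s), (u * r); split.
- by rewrite -mulrA (mulrA (s * x)) eu ee.
- by rewrite mulrA uu.
- by rewrite -mulrA eu.
- by rewrite mulrA.
- have -> : u - u * (s * x) = u * (1 - s * x) * u.
    by rewrite mulrBr mulrBl mulr1 uu -(mulrA u) eu.
  by rewrite e1 -!mulrA mulrBl mul1r xu.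
Qed.

(** The [w i * x i] are orthogonal idempotents with sum u. A general idempotent u instead of 1 lets
    the induction pass to the corner of u - e, once an idempotent e of the left ideal generated by
    [x i0] is split off. *)
Lemma exchange_ring_orthogonal (I : eqType) (s : seq I) (u : E) (x : I -> E) :
  uniq s -> u * u = u -> (forall i, u * x i = x i) -> (forall i, x i * u = x i) ->
  \sum_(i <- s) x i = u ->
  exists w : I -> E, [/\ forall i, i \in s -> w i * x i * w i = w i,
    forall i j, i \in s -> j \in s -> i != j -> w i * x i * w j = 0,
    forall i, u * w i = w i &
    \sum_(i <- s) w i * x i = u].
Proof.
elim: s u x => [|i0 s IHs] u x /= us uu ux xu sx.
  exists (fun=> 0); split=> // [i|]; first by rewrite mulr0.
  by rewrite -sx !big_nil.
case/andP: us => i0s us; rewrite big_cons in sx.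
have [e [t [r [ee ue eu ex u'x]]]] := exchange_ring_corner uu (ux i0) (xu i0).
have [u' u'E] : exists u', u' = u - e by eexists.
have u'u' : u' * u' = u' by rewrite u'E mulrBl !mulrBr uu eu ue ee subrr subr0.
have uu' : u * u' = u' by rewrite u'E mulrBr uu ue.
have sx' : u - x i0 = \sum_(i <- s) x i by rewrite -sx addrC addKr.
(* By u - e = r (u - x i0), these elements of the corner of u' sum to u'. *)
have [|||w' [w'K w'0 u'w' sw']] := IHs u' (fun i => u' * r * x i * u') us u'u'.
- by move=> i; rewrite !mulrA u'u'.
- by move=> i; rewrite -!mulrA u'u'.
- by rewrite -mulr_suml -mulr_sumr -sx' -(mulrA u') -u'x -u'E !u'u'.
have [w [wE xwE]] : exists w : I -> E, (forall i, w i = w' i * u' * r) /\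
    forall i j, i \in s -> j \in s -> w i * x i * w j = (i == j)%:R * w j.
  exists (fun i => w' i * u' * r); split=> // i j si sj.
  have -> : w' i * u' * r * x i * (w' j * u' * r) =
      w' i * (u' * r * x i * u') * w' j * u' * r.
    by rewrite -{1}(u'w' j) !mulrA.
  case: eqVneq => [<-|ij]; first by rewrite w'K // mul1r.
  by rewrite w'0 // !mul0r.
have uw i : u * w i = w i by rewrite wE !mulrA -u'w' mulrA uu'.
have [g gE] : exists g, g = \sum_(i <- s) w i * x i by eexists.
have gw j : j \in s -> g * w j = w j.
  move=> sj; rewrite gE mulr_suml (bigD1_seq j) //= xwE // eqxx mul1r.
  rewrite big_seq_cond big1 ?addr0 // => i /andP[si ij].
  by rewrite xwE // (negbTE ij) mul0r.
have gg : g * g = g.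
  rewrite {2 3}gE mulr_sumr big_seq [RHS]big_seq; apply: eq_bigr => j sj.
  by rewrite mulrA gw.
have gu : g * u = g.
  by rewrite gE mulr_suml; apply: eq_bigr => i _; rewrite -mulrA xu.
have ug : u * g = g.
  by rewrite gE mulr_sumr; apply: eq_bigr => i _; rewrite mulrA uw.
have gu' : g * u' = u'.
  rewrite -[RHS]sw' gE mulr_suml; apply: eq_bigr => i _.
  by rewrite wE !mulrA.
(* The index i0 must contribute the remaining idempotent u - g. It is a left multiple of e because g
   u' = u', and e is one of [x i0]. *)
have ugx : (u - g) * t * x i0 = u - g.
  rewrite -mulrA -ex -[RHS](_ : (u - g) * (e + u') = _).
    by rewrite mulrDr (mulrBl u') gu' uu' subrr addr0.
  by rewrite u'E subrKC mulrBl uu gu.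
exists (fun i => if i == i0 then (u - g) * t else w i).
have neq i : i \in s -> i == i0 = false.
  by move=> si; apply: contraNF i0s => /eqP <-.
have ugug : (u - g) * (u - g) = u - g.
  by rewrite mulrBl !mulrBr uu ug gu gg subrr subr0.
have wxg i : i \in s -> w i * x i * g = w i * x i.
  move=> si; rewrite gE mulr_sumr (bigD1_seq i) //= mulrA xwE // eqxx mul1r.
  rewrite big_seq_cond big1 ?addr0 // => j /andP[sj ij].
  by rewrite mulrA xwE // eq_sym (negbTE ij) !mul0r.
split=> [i|i j|i|].
- rewrite inE => /predU1P[->|si]; first by rewrite eqxx ugx mulrA ugug.
  by rewrite neq // xwE // eqxx mul1r.
- rewrite !inE => /predU1P[->|si] /predU1P[->|sj]; rewrite ?eqxx // => ij.
  + by rewrite ugx neq // mulrBl uw gw // subrr.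
  + by rewrite neq // mulrA mulrBr -mulrA xu wxg // subrr mul0r.
  + by rewrite !neq // xwE // (negbTE ij) mul0r.
- by case: ifP => // _; rewrite mulrA mulrBr uu ug.
- rewrite big_cons eqxx ugx big_seq (eq_bigr (fun i => w i * x i)).
    by rewrite -big_seq -gE subrK.
  by move=> i si; rewrite neq.
Qed.

End ExchangeRing.

(** Independence uses [w i * x i * w j = 0], which is stronger than orthogonality of the
    [w i * x i]: applying [w i * x i] to a vanishing sum of the w j (pi (e j a)) isolates the term
    at i. *)
Lemma exchange_ring_finite_exchange (K : pzRingType) (M : lmodType K) :
  exchange_ring (End M) -> finite_exchange M.
Proof.
move=> exM I; apply/exchange_operatorsP => A e iota pi eP iotaK.
have [eK e0 efin esum] := eP.
pose x i : End M := (pi \o (e i \o iota)) : {linear M -> M}.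
have fsumI (V : zmodType) (F : I -> V) :
    \sum_(i \in [set: I]) F i = \sum_(i <- enum I) F i.
  by apply: fsum_seq (enum_uniq I) _ => i _; rewrite mem_enum.
have sumEnd (s : seq I) (f : I -> End M) m :
    (\sum_(i <- s) f i : End M) m = \sum_(i <- s) f i m.
  by elim: s => [|i s IHs]; rewrite ?big_nil ?big_cons //= -IHs.
have sx : \sum_(i <- enum I) x i = 1.
  apply: End_ext => m; rewrite sumEnd /= -[RHS]iotaK [in RHS](esum (iota m)) fsumI.
  by rewrite linear_sum.
have [|||||w [wK w0 _ sw]] := @exchange_ring_orthogonal (End M) exM I (enum I) 1 x.
- exact: enum_uniq.
- by rewrite mulr1.
- by move=> i; rewrite mul1r.
- by move=> i; rewrite mulr1.
- by [].
apply: (@exchange_from_family _ _ _ _ e iota pi w idfun) => // [m|a sa0 i].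
  rewrite fsumI -[RHS]/((1 : End M) m) -sw sumEnd /=.
  by apply: eq_bigr.
have wwK : w i (x i (w i (pi (e i a)))) = w i (pi (e i a)).
  by rewrite -[RHS]/((w i : End M) _) -{3}wK ?mem_enum.
rewrite -wwK -[RHS](linear0 (w i * x i : End M)) -sa0 fsumI.
rewrite linear_sum (bigD1_seq i) ?mem_enum ?enum_uniq //= big1 ?addr0 // => j ji.
by rewrite -[LHS]/((w i * x i * w j : End M) _) w0 ?mem_enum // eq_sym.
Qed.

(** * Full exchange for abelian regular endomorphism rings *)

Lemma well_founded_total (T : eqType) : exists lt : rel T,
  well_founded lt /\ forall i j, i != j -> lt i j || lt j i.
Proof.
have [R Rwo] := well_ordering_principle T.
exists (fun i j => (i != j) && R i j); split; last first.
  move=> i j ij; rewrite (eq_sym j) ij /=.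
  have [|k [[]]] := Rwo (pred2 i j); first by exists i; rewrite inE eqxx.
  by move=> /orP[/eqP->|/eqP->] Rk _; rewrite Rk ?inE ?eqxx ?orbT.
move=> i; apply: contrapT => ni.
have [|k [[/asboolP nk mink] _]] :=
    Rwo (fun j => `[< ~ Acc (fun i j => (i != j) && R i j) j >]).
  by exists i; apply/asboolP.
apply: nk; apply: Acc_intro => j /andP[jk Rjk].
apply: contrapT => nj; have Rkj := mink j (introT (asboolP _) nj).
have Rch : wo_chain R predT by move=> A _; apply: Rwo.
by case/eqP: jk; apply: (wo_chain_antisymmetric Rch); rewrite ?Rjk.
Qed.

Section EndomorphismSums.
Variables (K : pzRingType) (L : lmodType K) (I : choiceType).
Local Notation E := (End L).
Implicit Types (a b : E) (c d : I -> E).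

Definition summable c : Prop := forall m, finsupp (c^~ m).

(** The default 0 makes the sum total, so that a family can be defined by recursion through [sumEnd]
    before its summability is known. *)
Definition sumEnd c : E :=
  if pselect (summable c) is left cfin then linear_of (fsum_is_linear cfin) else 0.

Lemma sumEndE c m : summable c -> sumEnd c m = \sum_(i \in [set: I]) c i m.
Proof. by rewrite /sumEnd; case: pselect. Qed.

Lemma summable_mull b c : summable c -> summable (fun i => b * c i).
Proof. by move=> cs m; apply: finsupp_subset (cs m) _ => i /= ->; apply: linear0. Qed.

Lemma summable_mulr b c : summable c -> summable (fun i => c i * b).
Proof. by move=> cs m; apply: cs. Qed.

Lemma summableD c d : summable c -> summable d -> summable (fun i => c i + d i).
Proof. by move=> cs ds m; apply: finsuppD. Qed.

Lemma summableN c : summable c -> summable (fun i => - c i).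
Proof. by move=> cs m; apply: finsupp_subset (cs m) _ => i /= ->; rewrite oppr0. Qed.

Lemma sumEnd_mull b c : summable c -> b * sumEnd c = sumEnd (fun i => b * c i).
Proof.
move=> cs; apply: End_ext => m; rewrite (sumEndE _ (summable_mull b cs)) /=.
by rewrite sumEndE // fsum_linear.
Qed.

Lemma sumEnd_mulr b c : summable c -> sumEnd c * b = sumEnd (fun i => c i * b).
Proof.
move=> cs; apply: End_ext => m; rewrite (sumEndE _ (summable_mulr b cs)) /=.
by rewrite sumEndE.
Qed.

Lemma sumEndB c d : summable c -> summable d ->
  sumEnd c - sumEnd d = sumEnd (fun i => c i - d i).
Proof.
move=> cs ds; apply: End_ext => m.
rewrite (sumEndE _ (summableD cs (summableN ds))) /= !sumEndE //.
rewrite (fsum_raddf (-%R : {additive L -> L})) // -fsumD //.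
exact: (summableN ds).
Qed.

Lemma sumEnd1 c i0 : (forall i, i != i0 -> c i = 0) -> sumEnd c = c i0.
Proof.
move=> c0; apply: End_ext => m; rewrite sumEndE.
  by apply: fsum1 => i /c0 ->.
move=> m'; apply: (seq_finsupp (s := [:: i0])) => i.
by rewrite inE; apply: contraNT => /c0 ->.
Qed.

End EndomorphismSums.

Section AbelianRegularFullExchange.
Variables (K : pzRingType) (L : lmodType K) (Q : pzRingType).
Local Notation E := (End L).
(** [rho 1] need not be 1: the intended map is a ring morphism on End M restricted to the corner End
    L, which sends 1 to the idempotent of that corner. *)
Variable rho : E -> Q.
Hypotheses (rhoB : forall a b, rho (a - b) = rho a - rho b)
  (rhoM : forall a b, rho (a * b) = rho a * rho b)
  (rho_unit : forall a, rho a = rho 1 -> exists b, b * a = 1 /\ a * b = 1)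
  (rho_regular : forall a, exists b, rho a = rho a * rho b * rho a)
  (rho_lift : forall a, rho a * rho a = rho a ->
     exists e, e * e = e /\ rho e = rho a)
  (rho_abelian : forall a b, rho a * rho a = rho a -> rho a * rho b = rho b * rho a).

Let rho0 : rho 0 = 0.
Proof. by rewrite -(subrr 0) rhoB subrr. Qed.

Let rhoN a : rho (- a) = - rho a.
Proof. by rewrite -sub0r rhoB rho0 sub0r. Qed.

Let rhoD a b : rho (a + b) = rho a + rho b.
Proof. by rewrite -[b]opprK rhoB !rhoN opprK. Qed.

Let rho1l a : rho 1 * rho a = rho a. Proof. by rewrite -rhoM mul1r. Qed.
Let rho1r a : rho a * rho 1 = rho a. Proof. by rewrite -rhoM mulr1. Qed.

(** A lift e of the idempotent ba need not be a left multiple of a. But u = 1 - e + e b a is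
    congruent to 1, hence a unit, and the conjugate of e by u is u^-1 e b a. Replacing w = u^-1 e b
    by w a w gives the first equation. *)
Lemma rho_idempotent_mull a b : rho a = rho a * rho b * rho a ->
  exists w, [/\ w * a * w = w, rho (w * a) = rho (b * a) & rho a = rho a * rho (w * a)].
Proof.
move=> aba; have [|e [ee re]] := @rho_lift (b * a).
  by rewrite !rhoM -mulrA (mulrA (rho a)) -aba.
have ru : rho (1 - e + e * (b * a)) = rho 1.
  by rewrite rhoD rhoB rhoM -re -rhoM ee subrK.
have [u' [u'u uu']] := rho_unit ru.
have eu : e * (1 - e + e * (b * a)) = e * (b * a).
  by rewrite mulrDr mulrBr mulr1 ee subrr add0r mulrA ee.
have ru' : rho u' = rho 1.
  by rewrite -(rho1r u') -ru -rhoM u'u.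
have [w [wE waa rwa]] : exists w,
    [/\ w * a = u' * e * (1 - e + e * (b * a)), w * a * (w * a) = w * a &
        rho (w * a) = rho (b * a)].
  have wa : u' * e * b * a = u' * e * (1 - e + e * (b * a)) by rewrite -!mulrA eu.
  exists (u' * e * b); split=> //.
    by rewrite wa -!mulrA (mulrA _ u') uu' mul1r (mulrA e) ee.
  by rewrite -!mulrA rhoM ru' rho1l rhoM re !rhoM -!mulrA (mulrA (rho a)) -aba.
have wwa : w * a * w * a = w * a by rewrite -mulrA waa.
exists (w * a * w); rewrite wwa; split=> //; first by rewrite mulrA waa.
by rewrite rwa rhoM mulrA.
Qed.

Section Sums.
Variable I : choiceType.
Implicit Types c d : I -> E.

(* If g = w (sum c) is idempotent then each vector g m is fixed by a finite
   partial sum of the w (c i), an element whose difference with 1 is a unit. *)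
Lemma rho_sumEnd0 c : summable c -> (forall i, rho (c i) = 0) -> rho (sumEnd c) = 0.
Proof.
move=> cs c0; have [b] := rho_regular (sumEnd c).
move=> /rho_idempotent_mull[w [wcw _ ->]].
suff -> : w * sumEnd c = 0 by rewrite rho0 mulr0.
apply: End_ext => m; set n := (w * sumEnd c : E) m.
have nn : (w * sumEnd c : E) n = n.
  by rewrite /n -[LHS]/((w * sumEnd c * (w * sumEnd c) : E) m) mulrA wcw.
have wcs := summable_mull w cs; have [s [us sP]] := finsupp_seq (wcs n).
have ns : n = (\sum_(i <- s) w * c i : E) n.
  rewrite -{1}nn sumEnd_mull // sumEndE // (fsum_seq us sP).
  by elim: {us sP} s => [|i s IHs]; rewrite ?big_nil ?big_cons //= -IHs.
have [|u [u1 _]] := @rho_unit (1 - \sum_(i <- s) w * c i).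
  rewrite rhoB; suff -> : rho (\sum_(i <- s) w * c i) = 0 by rewrite subr0.
  elim: {us sP ns} s => [|i s IHs]; first by rewrite big_nil rho0.
  by rewrite big_cons rhoD IHs rhoM c0 mulr0 addr0.
transitivity ((u * (1 - \sum_(i <- s) w * c i) : E) n); first by rewrite u1.
by rewrite /= -ns subrr linear0.
Qed.

Lemma eq_rho_sumEnd c d : summable c -> summable d ->
  (forall i, rho (c i) = rho (d i)) -> rho (sumEnd c) = rho (sumEnd d).
Proof.
move=> cs ds cd; apply/eqP; rewrite -subr_eq0 -rhoB sumEndB //.
apply/eqP/rho_sumEnd0 => [|i]; last by rewrite rhoB cd subrr.
exact: (summableD cs (summableN ds)).
Qed.

Lemma rho_sumEnd_orthogonal c : summable c ->
  (forall i, rho (c i) * rho (c i) = rho (c i)) ->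
  (forall i j, i != j -> rho (c i) * rho (c j) = 0) ->
  (forall k, rho (sumEnd c) * rho (c k) = rho (c k)) /\
  rho (sumEnd c) * rho (sumEnd c) = rho (sumEnd c).
Proof.
move=> cs cc c0.
have cK k : rho (sumEnd c) * rho (c k) = rho (c k).
  have ck : sumEnd (fun i => if i == k then c k else 0) = c k.
    by rewrite (sumEnd1 (i0 := k)) ?eqxx // => i /negbTE ->.
  rewrite -rhoM sumEnd_mulr // -[in RHS]ck.
  apply: eq_rho_sumEnd => [|m|i]; first exact: summable_mulr.
    apply: (seq_finsupp (s := [:: k])) => i; rewrite inE.
    by case: ifP => //; rewrite eqxx.
  by rewrite rhoM; case: eqVneq => [->|ik]; rewrite ?cc ?c0 ?rho0.
split=> //; rewrite -rhoM sumEnd_mull //.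
apply: eq_rho_sumEnd => // [|i]; first exact: summable_mull.
by rewrite rhoM cK.
Qed.

(** Since 1 - m i0 i0 is a unit, the equation at i0 expresses [b i0] through the other vectors;
    substitution leaves a smaller system whose coefficients are again in the kernel of [rho]. *)
Lemma rho_independent (s : seq I) (b : I -> L) (m : I -> I -> E) :
  (forall i j, rho (m i j) = 0) ->
  (forall j, j \in s -> b j = \sum_(i <- s) m j i (b i)) ->
  forall j, j \in s -> b j = 0.
Proof.
elim: s m => [//|i0 s IHs] m m0 bm.
have [|n [n1 _]] := @rho_unit (1 - m i0 i0); first by rewrite rhoB m0 subr0.
have b0 : b i0 = n (\sum_(i <- s) m i0 i (b i)).
  have := bm i0; rewrite inE eqxx big_cons => /(_ isT) bi0.
  transitivity ((n * (1 - m i0 i0) : E) (b i0)); first by rewrite n1.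
  by rewrite /= {1}bi0 addrC addKr.
have bs : forall j, j \in s -> b j = 0.
  apply: (IHs (fun j i => m j i + m j i0 * n * m i0 i)).
    by move=> i j; rewrite rhoD !rhoM !m0 !mul0r addr0.
  move=> j sj; rewrite {1}bm ?inE ?sj ?orbT // big_cons b0 !linear_sum /=.
  by rewrite -big_split; apply: eq_bigr => i _ /=; rewrite addrC.
move=> j; rewrite inE => /predU1P[->|]; last exact: bs.
rewrite b0 big_seq big1 ?linear0 // => i si.
by rewrite bs ?linear0.
Qed.

(** Applying [f j] to the relation gives b j = - sum of f j (f l (b l)) over l other than j, a
    system with coefficients in the kernel. *)
Lemma rho_orthogonal_independent (f : I -> E) (b : I -> L) :
  (forall i j, i != j -> rho (f i) * rho (f j) = 0) ->
  (forall i, f i (b i) = b i) -> finsupp b ->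
  \sum_(i \in [set: I]) b i = 0 -> forall i, b i = 0.
Proof.
move=> f0 fb /finsupp_seq[s [us bs]] sb i; rewrite (fsum_seq us bs) in sb.
apply/eqP; apply: contraT => /[dup] bi /bs si; rewrite -(negbTE bi).
pose m j l : E := if l == j then 0 else - (f j * f l).
apply/eqP; apply: (@rho_independent s b m _ _ i si) => [j l|j sj].
  by rewrite /m; case: eqVneq => [_|lj]; rewrite ?rho0 ?rhoN ?rhoM ?f0 ?oppr0 // eq_sym.
have := congr1 (f j) sb; rewrite linear0 linear_sum /= (bigD1_seq j) //= fb.
move=> /eqP; rewrite addr_eq0 => /eqP ->; rewrite (bigD1_seq j) //= /m eqxx add0r.
rewrite -sumrN; apply: eq_bigr => l /negbTE lj.
by rewrite lj /= fb.
Qed.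

(* The elements c i = (1 - sum of the c j with j < i) * w i * x i, defined by
   recursion along a well-order, are orthogonal idempotents modulo the kernel
   of rho; each is then replaced by an idempotent of the left ideal E (c i). *)
Lemma rho_orthogonalise (x : I -> E) : summable x -> sumEnd x = 1 ->
  exists z : I -> E, [/\ forall i, z i * x i * z i = z i,
    forall i j, i != j -> rho (z i * x i) * rho (z j * x j) = 0 &
    rho (sumEnd (fun i => z i * x i)) = rho 1].
Proof.
move=> xs sx; have [lt [lt_wf lt_total]] := well_founded_total I.
have /choice[w wP] i :
    exists w, w * x i * w = w /\ rho (x i) = rho (x i) * rho (w * x i).
  by have [b /rho_idempotent_mull[w [? _ ?]]] := rho_regular (x i); exists w.
pose below (c : I -> E) i := sumEnd (fun j => if lt j i then c j else 0).
have [c cE] : exists c, forall i, c i = (1 - below c i) * (w i * x i).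
  pose F i (rec : forall j, lt j i -> E) : E :=
    (1 - sumEnd (fun j => if pselect (lt j i) is left ji then rec j ji else 0)) *
    (w i * x i).
  exists (Fix lt_wf (fun=> E) F) => i; rewrite Fix_eq => [|{}i f g fg]; last first.
    congr ((1 - sumEnd _) * _); apply/funext => j.
    by case: pselect.
  congr ((1 - sumEnd _) * _); apply/funext => j.
  by case: pselect => [->|/negP/negbTE ->].
have cs : summable c.
  move=> m; apply: finsupp_subset (xs m) _ => i xm.
  rewrite cE -[LHS]/((1 - below c i : E) (w i (x i m))) xm.
  by rewrite (linear0 (w i)) (linear0 (1 - below c i : E)).
have bs i : summable (fun j => if lt j i then c j else 0).
  move=> m; apply: finsupp_subset (cs m) _ => j cm.
  by case: ifP.
have cc : forall i, rho (c i) * rho (c i) = rho (c i) /\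
    forall k, lt k i -> rho (c i) * rho (c k) = 0.
  move=> i; elim/(well_founded_ind lt_wf): i => i IH.
  have [||bc bb] := rho_sumEnd_orthogonal (bs i).
  - move=> j; case: ifP => [/IH[]//|_]; by rewrite rho0 mul0r.
  - move=> j k jk; case: ifP => [ji|_]; last by rewrite rho0 mul0r.
    case: ifP => [ki|_]; last by rewrite rho0 mulr0.
    have [jj jl] := IH j ji; have [kk kl] := IH k ki.
    by have /orP[/kl|/jl//] := lt_total j k jk; rewrite (rho_abelian _ kk).
  have b'b' : rho (1 - below c i) * rho (1 - below c i) = rho (1 - below c i).
    have b'b0 : rho ((1 - below c i) * below c i) = 0.
      by rewrite mulrBl mul1r rhoB rhoM bb subrr.
    by rewrite -rhoM mulrBr mulr1 rhoB b'b0 subr0.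
  have wx : rho (w i * x i) * rho (w i * x i) = rho (w i * x i).
    by rewrite -rhoM mulrA; have [-> _] := wP i.
  split=> [|k ki].
    rewrite cE rhoM -mulrA (mulrA (rho (w i * x i))) (rho_abelian _ wx).
    by rewrite -mulrA wx mulrA b'b'.
  rewrite cE rhoM (rho_abelian _ b'b') -mulrA rhoB mulrBl rho1l.
  by have := bc k; rewrite ki => ->; rewrite subrr mulr0.
have cidem i : rho (c i) * rho (c i) = rho (c i) by have [] := cc i.
have corth i j : i != j -> rho (c i) * rho (c j) = 0.
  move=> /lt_total/orP[ij|ji]; last by have [_ ->] := cc i.
  by rewrite (rho_abelian _ (cidem i)); have [_ ->] := cc j.
have [Cc CC] := rho_sumEnd_orthogonal cs cidem corth.
set C := sumEnd c in Cc CC.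
have Cb i : rho C * rho (below c i) = rho (below c i).
  rewrite -rhoM sumEnd_mull; last exact: bs.
  apply: eq_rho_sumEnd => [||j]; [exact: summable_mull | exact: bs |].
  by rewrite rhoM; case: ifP; rewrite ?Cc ?rho0 ?mulr0.
(* Modulo the kernel, [w i * x i] is [c i] plus a right multiple of [below c i], and [C] fixes both
   on the left. So [C] fixes every [x i], and hence their sum 1. *)
have Cx i : rho C * rho (x i) = rho (x i).
  have [_ xE] := wP i; rewrite xE mulrA (rho_abelian _ CC) -mulrA; congr (_ * _).
  have gE : rho (w i * x i) = rho (c i) + rho (below c i) * rho (w i * x i).
    by rewrite cE -rhoM -rhoD mulrBl mul1r subrK.
  by rewrite {1}gE mulrDr mulrA Cc Cb -gE.
have C1 : rho C = rho 1.
  rewrite -[C in LHS]mulr1 -sx sumEnd_mull //.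
  apply: eq_rho_sumEnd => // [|i]; first exact: summable_mull.
  by rewrite rhoM Cx.
have /choice[u uP] i : exists u, u * c i * u = u /\ rho (u * c i) = rho (c i).
  have [|u [uK uc _]] := @rho_idempotent_mull (c i) 1; last first.
    by exists u; rewrite uc mul1r.
  by rewrite rho1r cidem.
exists (fun i => u i * (1 - below c i) * w i).
have zx i : u i * (1 - below c i) * w i * x i = u i * c i by rewrite cE !mulrA.
split=> [i|i j ij|].
- by rewrite zx !mulrA; have [-> _] := uP i.
- by rewrite !zx; have [_ ->] := uP i; have [_ ->] := uP j; apply: corth.
- rewrite -C1; apply: eq_rho_sumEnd => // [|i]; last by rewrite zx; have [_ ->] := uP i.
  by move=> m; apply: finsupp_subset (cs m) _ => i cm; rewrite zx /= cm linear0.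
Qed.

End Sums.
(** The [z i * x i] are orthogonal with sum 1 only modulo the kernel: [v] inverts their actual sum,
    a unit, and elimination replaces exact orthogonality. *)
Theorem abelian_regular_full_exchange : full_exchange L.
Proof.
move=> I; apply/exchange_operatorsP => A e iota pi eP iotaK.
have [eK e0 efin esum] := eP.
pose x i : E := (pi \o (e i \o iota)) : {linear L -> L}.
have xs : summable x.
  by move=> m; apply: finsupp_subset (efin (iota m)) _ => i /= ->; rewrite linear0.
have sx : sumEnd x = 1.
  apply: End_ext => m; rewrite sumEndE //= -[RHS]iotaK [in RHS](esum (iota m)).
  by rewrite fsum_linear.
have [z [zK z0 zs]] := rho_orthogonalise xs sx.
have zxs : summable (fun i => z i * x i).
  by move=> m; apply: finsupp_subset (xs m) _ => i /= ->; rewrite linear0.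
have [v [vz zv]] := rho_unit zs.
apply: (@exchange_from_family _ _ _ _ e iota pi z v) => // [m|a sa0|].
- by rewrite -[RHS]/((1 : E) m) -vz /= sumEndE.
- apply: (rho_orthogonal_independent (f := fun i => z i * x i)) => //.
    by move=> i; rewrite -[LHS]/((z i * x i * z i : E) _) zK.
  by apply: finsupp_subset (efin a) _ => i ->; rewrite !linear0.
- apply: (can_inj (g := sumEnd (fun i => z i * x i))) => m.
  by rewrite -[LHS]/((_ * v : E) m) zv.
Qed.

End AbelianRegularFullExchange.

(** * Direct summands *)

Section Summand.
Variables (K : pzRingType) (M N : lmodType K) (Q : pzRingType).
Variables (rho : End M -> Q) (iota : {linear N -> M}) (pi : {linear M -> N}).
Hypotheses (rhoB : forall a b, rho (a - b) = rho a - rho b)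
  (rhoM : forall a b, rho (a * b) = rho a * rho b)
  (rho_1 : rho 1 = 1)
  (rho_unit : forall a, rho a = 1 -> exists b, b * a = 1 /\ a * b = 1)
  (rho_lift : forall a, rho a * rho a = rho a ->
     exists e, e * e = e /\ rho e = rho a)
  (iotaK : cancel iota pi).

Definition extend (x : End N) : End M :=
  (iota \o (x \o pi : {linear M -> N})) : {linear M -> M}.

Definition compress (a : End M) : End N :=
  (pi \o (a \o iota : {linear N -> M})) : {linear N -> N}.

Hypothesis rho_regular : forall x, exists b,
  rho (extend x) = rho (extend x) * rho b * rho (extend x).

Let rhoD a b : rho (a + b) = rho a + rho b.
Proof.
have rho_0 : rho 0 = 0 by rewrite -(subrr 0) rhoB subrr.
by rewrite -{1}[b]opprK rhoB -sub0r rhoB rho_0 sub0r opprK.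
Qed.

(** With s0 = b + (1 - b a) one has 1 - s0 a = (1 - b a)(1 - a), and s0 a is idempotent modulo the
    kernel. A lift e of it is conjugated by v = e s0 a + (1 - e)(1 - s0 a), a unit congruent to 1:
    this moves e into the left ideal of a and 1 - e into that of 1 - a. *)
Lemma rho_exchange a b : rho a = rho a * rho b * rho a ->
  exists s r, s * a * (s * a) = s * a /\ 1 - s * a = r * (1 - a).
Proof.
move=> aba.
have [s0 [s0E w0E]] : exists s0, s0 = b + (1 - b * a) /\
    1 - s0 * a = (1 - b * a) * (1 - a).
  exists (b + (1 - b * a)); split=> //.
  by rewrite [_ * a]mulrDl [RHS]mulrBr mulr1 opprD addrA.
have ba : rho (b * a) * rho (b * a) = rho (b * a).
  by rewrite !rhoM -mulrA (mulrA (rho a)) -aba.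
have w1 : rho (1 - a) * rho (1 - b * a) = rho (1 - b * a).
  have a0 : rho (a * (1 - b * a)) = 0.
    by rewrite mulrBr mulr1 rhoB mulrA !rhoM -aba subrr.
  by rewrite -rhoM [(1 - a) * _]mulrBl mul1r rhoB a0 subr0.
have w2 : rho (1 - b * a) * rho (1 - b * a) = rho (1 - b * a).
  have w0 : rho ((1 - b * a) * (b * a)) = 0.
    by rewrite mulrBl mul1r rhoB (rhoM (b * a)) ba subrr.
  by rewrite -rhoM mulrBr mulr1 rhoB w0 subr0.
have ww : rho (1 - s0 * a) * rho (1 - s0 * a) = rho (1 - s0 * a).
  by rewrite w0E rhoM -mulrA (mulrA (rho (1 - a))) w1 mulrA w2.
have [|e [ee re]] := @rho_lift (s0 * a).
  have w0 : rho (s0 * a) * rho (1 - s0 * a) = 0.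
    rewrite -{1}[s0 * a](subKr 1) rhoB mulrBl ww rho_1 mul1r subrr //.
  by rewrite -[RHS]mulr1 -rho_1 -[in RHS](subrK (s0 * a) 1) rhoD mulrDr w0 add0r.
have [v vE] : exists v, v = e * (s0 * a) + (1 - e) * (1 - s0 * a) by eexists.
have ee' : e * (1 - e) = 0 by rewrite mulrBr mulr1 ee subrr.
have e'e : (1 - e) * e = 0 by rewrite mulrBl mul1r ee subrr.
have e'e' : (1 - e) * (1 - e) = 1 - e by rewrite mulrBr mulr1 e'e subr0.
have ev : e * v = e * (s0 * a).
  by rewrite vE mulrDr (mulrA e e) ee (mulrA e (1 - e)) ee' mul0r addr0.
have e'v : (1 - e) * v = (1 - e) * (1 - s0 * a).
  by rewrite vE mulrDr (mulrA (1 - e) e) e'e mul0r add0r (mulrA (1 - e) (1 - e)) e'e'.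
have [|v' [v'v vv']] := @rho_unit v.
  have re' : rho (1 - e) = rho (1 - s0 * a) by rewrite !rhoB re.
  by rewrite vE rhoD (rhoM e) (rhoM (1 - e)) -re -re' -!rhoM ee e'e' -rhoD subrKC.
exists (v' * e * s0), (v' * (1 - e) * (1 - b * a)).
have sa : v' * e * s0 * a = v' * e * v by rewrite -!mulrA ev.
split; first by rewrite !sa -!mulrA (mulrA v v') vv' mul1r (mulrA e) ee.
rewrite sa -!mulrA -w0E -e'v mulrBl mul1r mulrBr v'v mulrA //.
Qed.

Lemma summand_exchange_ring : exchange_ring (End N).
Proof.
move=> x; have [b /rho_exchange[s [r [ss s1]]]] := rho_regular x.
exists (compress s), (compress r); split; apply: End_ext => n.
  have := congr1 (fun h : End M => pi (h (iota n))) ss.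
  by rewrite /= !iotaK.
have := congr1 (fun h : End M => pi (h (iota n))) s1.
by rewrite /= !linearB /= !iotaK.
Qed.

Let extendM x y : extend (x * y) = extend x * extend y.
Proof. by apply: End_ext => m /=; rewrite iotaK. Qed.

Let extendB x y : extend (x - y) = extend x - extend y.
Proof. by apply: End_ext => m /=; rewrite linearB. Qed.

Let extend_compress a : extend (compress a) = extend 1 * a * extend 1.
Proof. exact: End_ext. Qed.

Let extend1l x : extend 1 * extend x = extend x.
Proof. by rewrite -extendM mul1r. Qed.

Let extend1r x : extend x * extend 1 = extend x.
Proof. by rewrite -extendM mulr1. Qed.

Lemma abelian_summand_full_exchange :
  abelian_corner (rho (extend 1)) -> full_exchange N.
Proof.
move=> gab; apply: (@abelian_regular_full_exchange K N Q (rho \o extend)) => /=.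
- by move=> x y; rewrite extendB rhoB.
- by move=> x y; rewrite extendM rhoM.
- move=> x rx; have [|b [b1 b2]] := @rho_unit (1 - extend 1 + extend x).
    by rewrite rhoD rhoB rx subrK.
  exists (compress b); split; apply: End_ext => n.
    have := congr1 (fun h : End M => pi (h (iota n))) b1.
    by rewrite /= !iotaK subrr add0r.
  have := congr1 (fun h : End M => pi (h (iota n))) b2.
  by rewrite /= linearD linearB /= !iotaK subrr add0r.
- move=> x; have [b xbx] := rho_regular x; exists (compress b).
  have x1 : rho (extend x) * rho (extend 1) = rho (extend x) by rewrite -rhoM extend1r.
  have x1' : rho (extend 1) * rho (extend x) = rho (extend x) by rewrite -rhoM extend1l.
  by rewrite extend_compress !rhoM !mulrA x1 -(mulrA _ (rho (extend 1))) x1'.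
- move=> x xx; have [e [ee re]] := rho_lift xx.
  have ru : rho (1 - e + e * extend x) = 1.
    by rewrite rhoD rhoB rhoM re xx subrK.
  have [u' [u'u uu']] := rho_unit ru.
  have eu : e * (1 - e + e * extend x) = e * extend x.
    by rewrite mulrDr mulrBr mulr1 ee subrr add0r mulrA ee.
  (* The conjugate of [e] by the unit lies in the left ideal of [extend x]. Being fixed by
     [extend 1] on the right is enough for its compression to be idempotent. *)
  have [e2 [e2E e2f]] : exists e2, e2 = u' * e * (1 - e + e * extend x) /\
      e2 * extend 1 = e2.
    exists (u' * e * extend x); split; first by rewrite -!mulrA eu.
    by rewrite -mulrA extend1r.
  have e2e2 : e2 * e2 = e2.
    by rewrite e2E -!mulrA (mulrA _ u') uu' mul1r (mulrA e e) ee.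
  have ru' : rho u' = 1 by rewrite -[LHS]mulr1 -{1}ru -rhoM u'u.
  have re2 : rho e2 = rho (extend x).
    by rewrite e2E !rhoM ru ru' mul1r mulr1 re.
  exists (compress e2); split.
    apply: End_ext => n.
    have := congr1 (fun h : End M => pi (h (iota n))) e2e2.
    have := congr1 (fun h : End M => h (e2 (iota n))) e2f.
    by rewrite /= => ->.
  by rewrite extend_compress -mulrA e2f rhoM re2 -rhoM extend1l.
- move=> x y xx.
  by apply: (abelian_cornerC _ gab) => //; rewrite -?rhoM ?extend1l ?extend1r.
Qed.

End Summand.

Section ExchangeSum.
Variables (K : pzRingType) (M N L : lmodType K).
Variables (iN : {linear N -> M}) (pN : {linear M -> N})
  (iL : {linear L -> M}) (pL : {linear M -> L}).
Hypotheses (iNK : cancel iN pN) (iLK : cancel iL pL)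
  (NL : forall m, iN (pN m) + iL (pL m) = m).

Let pLiN n : pL (iN n) = 0.
Proof.
have := congr1 pL (NL (iN n)); rewrite linearD iNK iLK => /eqP.
by rewrite -subr_eq0 addrAC subrr add0r => /eqP.
Qed.

(* Exchange N first; its complement B is again a direct sum along the given
   family, and L embeds in B as a direct summand. *)
Lemma full_exchange_sum : full_exchange N -> full_exchange L -> full_exchange M.
Proof.
move=> exN exL I; apply/exchange_operatorsP => A e iota pi eP iotaK.
have [eK e0 efin esum] := eP.
have [|phiN [phiNK phiNe]] := (exchange_operatorsP I N).1 (exN I) A e
  (iota \o iN : {linear N -> A}) (pN \o pi : {linear A -> N}) eP.
  by move=> n /=; rewrite iotaK iNK.
have {}phiNK n : phiN (iota (iN n)) = n by exact: phiNK.
pose B := submodule_of (is_submodule_ker phiN).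
have BE a : a \in B <-> phiN a = 0 by exact: in_submodule_of.
have [v vE] := submodule_incl B.
have vinj : injective v by move=> x y; rewrite !vE => /val_inj.
have [r rE] : exists r : {linear A -> module_of B},
    forall a, v (r a) = a - iota (iN (phiN a)).
  pose h : {linear A -> A} := idfun \- (iota \o (iN \o phiN)).
  have hB a : h a \in B by apply/BE; rewrite linearB /= phiNK subrr.
  have rlin : linear (fun a => Sub (h a) (hB a) : module_of B).
    by move=> k a b; apply: val_inj; apply: (linearP h k a b).
  by exists (linear_of rlin) => a; rewrite vE SubK.
have phiNv b : phiN (v b) = 0 by rewrite vE; apply/BE/valP.
have rE0 a : phiN a = 0 -> v (r a) = a by move=> a0; rewrite rE a0 !linear0 addr0.
pose eB i : {linear module_of B -> module_of B} := r \o (e i \o v).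
have eBE i b : v (eB i b) = e i (v b) by rewrite /= rE0 // phiNe.
have eBP : projectors eB.
  split=> [i b|i j b ij|b|b].
  - by apply: (vinj); rewrite !eBE eK.
  - by apply: (vinj); rewrite !eBE e0 // linear0.
  - apply: finsupp_subset (efin (v b)) _ => i eb; apply: (vinj).
    by rewrite eBE eb linear0.
  - apply: (vinj); rewrite fsum_linear; last first.
      apply: finsupp_subset (efin (v b)) _ => i eb; apply: (vinj).
      by rewrite eBE eb linear0.
    by rewrite [LHS]esum; congr (\big[_/_]_(i \in _) _); apply/funext => i; rewrite eBE.
have [|phiL [phiLK phiLe]] := (exchange_operatorsP I L).1 (exL I) (module_of B) eB
  (r \o (iota \o iL) : {linear L -> module_of B})
  (pL \o (pi \o v) : {linear module_of B -> L}) eBP.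
  by move=> l; rewrite /= rE linearB /= !iotaK linearB /= iLK pLiN subr0.
(* With l = phiL (r a) as L-component, the N-component is read off from a - iota (iL l), because
   [phiN] need not vanish on iota (iL l). *)
pose phi : {linear A -> M} :=
  (iL \o (phiL \o r)) \+ (iN \o (phiN \- (phiN \o (iota \o (iL \o (phiL \o r)))))).
have phiE a : phi a =
    iL (phiL (r a)) + iN (phiN a - phiN (iota (iL (phiL (r a))))) by [].
exists phi; split=> [m|i a].
  have rm : phiL (r (iota m)) = pL m.
    rewrite -[RHS]phiLK /=; congr (phiL _); apply: (vinj); rewrite !rE.
    have -> : iota m = iota (iN (pN m)) + iota (iL (pL m)) by rewrite -linearD NL.
    rewrite (linearD phiN) phiNK (linearD iN) (linearD iota) opprD addrACA.
    by rewrite subrr add0r.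
  rewrite phiE rm -{2}(NL m) (linearD iota) (linearD phiN) phiNK addrK addrC.
  exact: NL.
rewrite !phiE => phia.
have l0 : phiL (r a) = 0.
  by have := congr1 pL phia; rewrite linearD iLK pLiN addr0 linear0.
move: phia; rewrite l0 !linear0 add0r addr0 => n0.
have a0 : phiN a = 0 by rewrite -[LHS]iNK n0 linear0.
have -> : r (e i a) = eB i (r a).
  by apply: (vinj); rewrite eBE !rE0 ?phiNe.
rewrite phiLe // phiNe // (linear0 iL) (linear0 iota) (linear0 phiN) subrr.
by rewrite (linear0 iN) addr0.
Qed.

End ExchangeSum.

(** * Coinvariant modules *)

Section JacobsonUnits.
Variable S : pzRingType.
Implicit Types (I : set S) (a b j s t x y : S).

Lemma maximal_right_ideal_above I : right_ideal I -> ~ I 1 ->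
  exists m, maximal_right_ideal m /\ I `<=` m.
Proof.
move=> rI I1.
have [//|F [A FA] FP Ftot|m [[rm m1] Im maxm]] :=
    @Zorn_above _ (fun A => right_ideal A /\ ~ A 1) I.
  split; last by move=> [B FB B1]; case: (FP B FB).
  split=> [|x y [B FB Bx] [B' FB' By]|x r [B FB Bx]].
  - by exists A => //; have [[A0 _ _] _] := FP A FA.
  - have [BB|BB] := Ftot _ _ FB FB'.
      exists B' => //; have [[_ B'B _] _] := FP B' FB'.
      by apply: B'B => //; apply: BB.
    exists B => //; have [[_ B'B _] _] := FP B FB.
    by apply: B'B => //; apply: BB.
  - by exists B => //; have [[_ _ BM] _] := FP B FB; apply: BM.
exists m; split=> //; split=> [//||L rL LT mL].
  by apply/eqP => mT; apply: m1; rewrite mT.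
apply/seteqP; split=> //; apply: maxm => //; split=> // L1.
by case/eqP: LT; apply: right_ideal1.
Qed.

Lemma jacobson_right_inverse j : jacobson j -> exists w, (1 - j) * w = 1.
Proof.
move=> Jj; apply: contrapT => nw.
have rI : right_ideal [set x | exists w, x = (1 - j) * w].
  split=> [|_ _ [w ->] [w' ->]|_ r [w ->]].
  - by exists 0; rewrite mulr0.
  - by exists (w - w'); rewrite mulrBr.
  - by exists (w * r); rewrite mulrA.
have [|m [mm Im]] := maximal_right_ideal_above rI.
  by move=> [w w1]; apply: nw; exists w.
case: (mm) => rm /eqP mT _; apply/mT/right_ideal1 => //.
rewrite -(subrK j 1); apply: right_idealD => //; last exact: Jj.
by apply: Im; exists 1; rewrite mulr1.
Qed.

Lemma jacobson_unit j : jacobson j -> exists w, (1 - j) * w = 1 /\ w * (1 - j) = 1.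
Proof.
move=> Jj; have [w w1] := jacobson_right_inverse Jj.
have [_ _ JM] := @jacobson_right_ideal S.
have [|w' w'1] := @jacobson_right_inverse (- (j * w)).
  by apply: (right_idealN (@jacobson_right_ideal S)); apply: JM.
have wE : 1 - - (j * w) = w by rewrite opprK -{1}w1 mulrBl mul1r subrK.
rewrite wE in w'1; exists w; split=> //.
by rewrite -{2}w'1 -[1 - j]mulr1 -{2}w'1 (mulrA _ w w') w1 mul1r.
Qed.

Lemma quasiregular_sub_jacobson I : right_ideal I ->
  (forall x, I x -> exists w, (1 - x) * w = 1) -> I `<=` @jacobson S.
Proof.
move=> [_ IB IM] qI x Ix m mm; case: (mm) => -[m0 mB mM] /eqP mT maxm.
pose L := [set z | exists y r, m y /\ z = y + x * r].
have rL : right_ideal L.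
  split=> [|_ _ [y [r [my ->]]] [y' [r' [my' ->]]]|_ s [y [r [my ->]]]].
  - by exists 0, 0; rewrite mulr0 addr0.
  - by exists (y - y'), (r - r'); rewrite mulrBr opprD addrACA; split=> //; apply: mB.
  - by exists (y * s), (r * s); rewrite mulrDl mulrA; split=> //; apply: mM.
have mL : m `<=` L by move=> y my; exists y, 0; rewrite mulr0 addr0.
case: (eqVneq L setT) => [LT|/maxm Lm]; last first.
  by rewrite -(Lm rL mL); exists 0, 1; rewrite mulr1 add0r.
have [y [r [my yr]]] : L 1 by rewrite LT.
have yE : y = 1 - x * r by rewrite yr addrK.
have [w w1] := qI _ (IM x r Ix).
by case: mT; apply: right_ideal1 => //; rewrite -w1 -yE; apply: mM.
Qed.

Local Notation pi := (@jacobson_pi S).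

Lemma jacobson_piB x y : pi (x - y) = pi x - pi y.
Proof.
rewrite -[RHS]/(jacobson_quot_add _ (jacobson_quot_opp _)).
by rewrite jacobson_quot_oppE jacobson_quot_addE.
Qed.

Lemma jacobson_piM x y : pi (x * y) = pi x * pi y.
Proof. exact/esym/jacobson_quot_mulE. Qed.

Lemma jacobson_pi_unit s t : pi s * pi t = 1 -> pi t * pi s = 1 ->
  exists w, s * w = 1 /\ w * s = 1.
Proof.
have inv a b : pi a * pi b = 1 -> exists w, a * b * w = 1 /\ w * (a * b) = 1.
  rewrite -jacobson_piM => ab; have [|w] := @jacobson_unit (1 - a * b).
    by apply/jacobson_quot_eqP; rewrite ab.
  by rewrite subKr; exists w.
move=> /inv[w [stw _]] /inv[w' [_ w'ts]].
exists (t * w); split; first by rewrite mulrA.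
suff -> : t * w = w' * t by rewrite -mulrA.
by rewrite -[LHS]mul1r -w'ts -!mulrA (mulrA s) stw mulr1.
Qed.

End JacobsonUnits.

(** * Descent of endomorphisms along a cover *)

Section CoinvariantEndomorphisms.
Variables (K : pzRingType) (X M : lmodType K) (p : {linear X -> M}).
Hypotheses (p_epi : epimorphic p)
  (p_lift : forall f : End M, exists s : End X, p \o s =1 f \o p)
  (p_cover : forall h : {linear X -> X}, p \o h =1 p -> bijective h)
  (p_coinv : forall g : {linear X -> X}, bijective g ->
     exists f : {linear M -> M}, f \o p =1 p \o g)
  (J_lift : idempotents_lift_mod_jacobson (End X)).

Lemma epi_End_eq (f g : End M) : f \o p =1 g \o p -> f = g.
Proof.
by move=> fg; apply: End_ext => m; have [x <-] := p_epi m; apply: fg.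
Qed.

Lemma End_unit_bijective (U : lmodType K) (u v : End U) :
  u * v = 1 -> v * u = 1 -> bijective u.
Proof.
move=> uv vu; exists v => x; first by rewrite -[LHS]/((v * u : End U) x) vu.
by rewrite -[LHS]/((u * v : End U) x) uv.
Qed.

(** The g with p g = 0 form a right ideal, and p (1 - g) = p makes 1 - g an automorphism by the
    cover property; a right ideal of this kind lies in the radical. *)
Lemma coinvariant_jacobson (s s' : End X) : p \o s =1 p \o s' -> jacobson (s - s').
Proof.
move=> ss'.
apply: (@quasiregular_sub_jacobson _ [set g : End X | forall x, p (g x) = 0]).
- split=> [x|g g' pg pg' x|g r pg x]; rewrite /= ?linear0 //.
    by rewrite linearB /= pg pg' subrr.
- move=> g pg; have [|w [wK Kw]] := @linear_inverse K X X ((1 : End X) - g).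
    by apply: p_cover => x; rewrite /= linearB /= pg subr0.
  by exists w; apply: End_ext => x; apply: Kw.
- by move=> x /=; have := ss' x; rewrite linearB /= => ->; rewrite subrr.
Qed.

Local Notation Q := (jacobson_quot (End X)).

Lemma coinvariant_rho : exists rho : End M -> Q,
  [/\ forall (f : End M) (s : End X), f \o p =1 p \o s -> rho f = jacobson_pi s,
      forall (f : End M) (s : End X), rho f = jacobson_pi s ->
        exists f' : {linear M -> M}, f' \o p =1 p \o s,
      forall a, rho a = 1 -> exists b, b * a = 1 /\ a * b = 1,
      forall a, rho a * rho a = rho a -> exists e, e * e = e /\ rho e = rho a &
      [/\ forall a b, rho (a - b) = rho a - rho b,
        forall a b, rho (a * b) = rho a * rho b, rho 1 = 1 &
        forall u v, u * v = 1 -> v * u = 1 -> exists f, rho f = u]].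
Proof.
have /choice[l lP] := p_lift; pose rho f : Q := jacobson_pi (l f).
have rhoE (f : End M) (s : End X) : f \o p =1 p \o s -> rho f = jacobson_pi s.
  move=> fs; apply/jacobson_quot_eqP.
  by apply: coinvariant_jacobson => x; rewrite lP fs.
have rho_pi (f : End M) (s : End X) : rho f = jacobson_pi s ->
    exists f' : {linear M -> M}, f' \o p =1 p \o s.
  move=> /jacobson_quot_eqP/jacobson_unit[w [w1 w2]].
  have [f1 f1P] := p_coinv (End_unit_bijective w1 w2).
  (* For j = l f - s in the radical, the unit 1 - j descends to f1, so j descends to 1 - f1 and s =
     l f - j to their difference. Descent thus depends only on the class modulo the radical. *)
  exists (f - (1 - (f1 : End M)) : End M) => x /=.
  have /= -> := f1P x; have /= <- := lP f x.
  by rewrite -!linearB /= !subKr.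
exists rho; split=> //.
- move=> a ra; have [|w [w1 w2]] := @jacobson_unit (End X) (1 - l a).
    exact/jacobson_quot_eqP/(esym ra).
  rewrite subKr in w1 w2; have [b bP] := p_coinv (End_unit_bijective w2 w1).
  exists b; split; apply: epi_End_eq => x /=.
    have /= <- := lP a x; have /= -> := bP (l a x).
    by rewrite -[w _]/((w * l a : End X) x) w2.
  have /= -> := bP x; have /= <- := lP a (w x).
  by rewrite -[l a _]/((l a * w : End X) x) w1.
- move=> a; rewrite -jacobson_piM => /jacobson_quot_eqP/J_lift.
  move=> [e [ee /jacobson_quot_eqP ea]].
  have [f fP] := rho_pi a e (esym ea).
  exists f; split; last by rewrite (rhoE f e fP).
  apply: epi_End_eq => x /=; have /= -> := fP x; have /= -> := fP (e x).
  by rewrite -[e (e x)]/((e * e : End X) x) ee.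
split=> [a b|a b||u v].
- rewrite -jacobson_piB; apply: rhoE => x /=.
  by rewrite linearB; have /= -> := lP a x; have /= -> := lP b x.
- rewrite -jacobson_piM; apply: rhoE => x /=.
  by have /= -> := lP a (l b x); have /= -> := lP b x.
- by apply: (rhoE _ 1).
- have [s ->] := jacobson_pi_surj u; have [t ->] := jacobson_pi_surj v => st ts.
  have [w [sw ws]] := jacobson_pi_unit st ts.
  by have [f fP] := p_coinv (End_unit_bijective sw ws); exists f; apply: rhoE.
Qed.

End CoinvariantEndomorphisms.

Lemma idempotent_splits (K : pzRingType) (M : lmodType K) (f : End M) : f * f = f ->
  exists N : submodule M, direct_summand N /\
  exists (iota : {linear module_of N -> M}) (pi : {linear M -> module_of N}),
    cancel iota pi /\ forall m, iota (pi m) = f m.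
Proof.
move=> ff; have fK m : f (f m) = f m by rewrite -[LHS]/((f * f : End M) m) ff.
pose N := submodule_of (is_submodule_fix f).
pose N' := submodule_of (is_submodule_ker f).
have NE m : m \in N <-> f m = m by exact: in_submodule_of.
have N'E m : m \in N' <-> f m = 0 by exact: in_submodule_of.
exists N; split.
  exists N'; apply: projectors_direct_sum (projectors2 fK (g := idfun \- f) _) _ => //.
  case=> m; first exact: NE.
  split=> [/N'E fm|/= <-]; first by rewrite /= fm subr0.
  by apply/N'E; rewrite /= linearB /= fK subrr.
have [v vE] := submodule_incl N.
have fN m : f m \in N by apply/NE.
have flin : linear (fun m => Sub (f m) (fN m) : module_of N).
  by move=> k a b; apply: val_inj; apply: (linearP f k a b).
exists v, (linear_of flin); split=> [n|m]; last by rewrite vE.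
by apply: val_inj; rewrite /= vE; apply/NE/(valP n).
Qed.

(** Coinvariance speaks of some cover q : Y -> M. Covers are unique up to an isomorphism h over M,
    and conjugation by h carries automorphisms of X to automorphisms of Y. *)
Lemma automorphism_coinvariant_cover (K : pzRingType) (C : lmodType K -> Prop)
    (X M : lmodType K) (p : {linear X -> M}) :
  is_cover C p -> automorphism_coinvariant C M ->
  forall g : {linear X -> X}, bijective g ->
  exists f : {linear M -> M}, f \o p =1 p \o g.
Proof.
move=> [[CX ppre] pcov] [Y [q [[[CY qpre] qcov] qcoinv]]] g [g' gK g'K].
have [h hP] := qpre X p CX; have [k kP] := ppre Y q CY.
have [hk1 hk1K hk1'] : bijective (h \o k).
  by apply: (qcov (h \o k)) => y /=; have /= -> := hP (k y); apply: kP.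
have [kh1 kh1K kh1'] : bijective (k \o h).
  by apply: (pcov (k \o h)) => x /=; have /= -> := kP (h x); apply: hP.
have hbij : bijective h.
  exists (kh1 \o k) => [x|y] /=; first exact: kh1K.
  have hinj : injective k by apply: (inj_compr (can_inj hk1K)).
  by apply: hinj; have := kh1' (k y).
have [h' [hK h'K]] := linear_inverse hbij.
have [|f fP] := qcoinv (h \o (g \o h') : {linear Y -> Y}).
  by exists (h \o (g' \o h')) => y /=; rewrite ?hK ?gK ?g'K ?h'K.
exists f => x /=; have /= <- := hP x; have /= -> := fP (h x).
by rewrite hK; apply: hP.
Qed.

(* The cover of the summand is a direct summand of X whose idempotent is
   congruent to that of f modulo the Jacobson radical. *)
Lemma summand_endomorphism_coinvariant (K : pzRingType) (C : lmodType K -> Prop)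
    (X M N : lmodType K) (p : {linear X -> M}) (rho : End M -> jacobson_quot (End X))
    (iota : {linear N -> M}) (pi : {linear M -> N}) (f : End M) :
  is_cover C p -> has_cover C N ->
  cancel iota pi -> (forall m, iota (pi m) = f m) ->
  (forall (a : End M) (s : End X), a \o p =1 p \o s -> rho a = jacobson_pi s) ->
  (forall (a : End M) (s : End X), rho a = jacobson_pi s ->
     exists a' : {linear M -> M}, a' \o p =1 p \o s) ->
  (forall q, exists a, rho a = rho f * q * rho f) ->
  endomorphism_coinvariant C N.
Proof.
move=> [[CX ppre] _] [Y [q [[CY qpre] qcov]]] iotaK iotapi rhoE rho_lift rho_corner.
exists Y, q; split=> // g.
have [h hP] := ppre Y (iota \o q : {linear Y -> M}) CY.
have [k kP] := qpre X (pi \o p : {linear X -> N}) CX.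
have khbij : bijective (k \o h).
  apply: (qcov (k \o h)) => y /=; have /= -> := kP (h y); have /= -> := hP y.
  exact: iotaK.
have [w [wK Kw]] := linear_inverse khbij.
have qw y : q (w y) = q y.
  rewrite -[in RHS](Kw y) /=; have /= -> := kP (h (w y)); have /= -> := hP (w y).
  by rewrite iotaK.
(* [e] is the idempotent of X with image h(Y), lying over [f]; [s] is [g] transported to that image.
   From e s e = s, the class of [s] lies in the corner of [rho f], so [s] descends. *)
pose e : End X := (h \o (w \o k) : {linear X -> X}).
pose s : End X := (h \o (g \o (w \o k)) : {linear X -> X}).
have fe : f \o p =1 p \o e.
  move=> x /=; have /= -> := hP (w (k x)); rewrite qw.
  by have /= -> := kP x; rewrite iotapi.
have ese : e * s * e = s.
  apply: End_ext => x; rewrite /=.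
  have wkh y : w (k (h y)) = y := wK y.
  by rewrite !wkh.
have [a aE] := rho_corner (jacobson_pi s).
have [a' a'P] : exists a' : {linear M -> M}, a' \o p =1 p \o s.
  apply: (rho_lift a); rewrite aE (rhoE f e fe).
  by rewrite -(jacobson_piM e s) -(jacobson_piM (e * s) e) ese.
exists (pi \o (a' \o iota)) => y /=.
have /= <- := hP y; have /= -> := a'P (h y); have /= -> := hP (g (w (k (h y)))).
by have -> : w (k (h y)) = y := wK y; rewrite iotaK.
Qed.

Theorem theorem4p10 (R : pzRingType) (C : rmodType R -> Prop)
    (X M : rmodType R) (p : {linear X -> M}) :
  iso_closed C ->
  is_cover C p ->
  epimorphic p ->
  von_neumann_regular (jacobson_quot (End X)) ->
  right_self_injective (jacobson_quot (End X)) ->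
  idempotents_lift_mod_jacobson (End X) ->
  automorphism_coinvariant C M ->
  (forall N : submodule M, direct_summand N -> has_cover C (module_of N)) ->
  (forall N : rmodType R,
      endomorphism_coinvariant C N -> finite_exchange N -> full_exchange N) ->
  full_exchange M.
Proof.
move=> _ pcover pepi Qreg Qinj Jlift Mcoinv sum_cover finite_full.
have [[CX ppre] pcov] := pcover.
have [||rho [rhoE rho_pi rho_unit rho_lift [rhoB rhoM rho1 rho_units]]] :=
    coinvariant_rho pepi _ pcov _ Jlift.
- by move=> f; apply: (ppre X (f \o p : {linear X -> M}) CX).
- exact: automorphism_coinvariant_cover pcover Mcoinv.
pose T : set (jacobson_quot (End X)) := [set q | exists f, rho f = q].
have unitT : subring_with_units T.
  split=> [u v uv vu|_ _ [a <-] [b <-]|_ _ [a <-] [b <-]]; first exact: rho_units uv vu.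
    by exists (a - b).
  by exists (a * b).
have [e [c1 [c2 [ee [ec1 c1e ec2 c2e] c21]]]] := square_free_complement Qreg Qinj.
have := subring_with_units_corner unitT ec1 c1e ec2 c2e c21.
have : (e + c1 * c2) * (e + c1 * c2) = e + c1 * c2.
  rewrite mulrDl !mulrDr ee mulrA ec1 mul0r addr0 -(mulrA c1 c2 e) c2e mulr0 add0r.
  by rewrite -mulrA (mulrA c2) c21 ec2.
move: (e + c1 * c2) => d dd Td dab {e c1 c2 ee ec1 c1e ec2 c2e c21}.
have [f0 f0d] : T d by have := Td 1; rewrite mulr1 dd.
have [|f [ff fd]] := rho_lift f0; first by rewrite f0d.
rewrite {}f0d {f0} in fd.
have f'f' : (1 - f) * (1 - f) = 1 - f.
  by rewrite mulrBr mulr1 mulrBl mul1r ff subrr subr0.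
have f'd : rho (1 - f) = 1 - d by rewrite rhoB rho1 fd.
have [N [sumN [iN [pN [iNK iNpN]]]]] := idempotent_splits ff.
have [L [_ [iL [pL [iLK iLpL]]]]] := idempotent_splits f'f'.
apply: (full_exchange_sum iNK iLK).
- by move=> m; rewrite iNpN iLpL /= subrKC.
- apply: finite_full.
    apply: (summand_endomorphism_coinvariant pcover (sum_cover N sumN) iNK iNpN rhoE rho_pi).
    by move=> q; rewrite fd; apply: Td.
  apply/exchange_ring_finite_exchange.
  apply: (summand_exchange_ring rhoB rhoM rho1 rho_unit rho_lift iNK) => x.
  have fx : f * extend iN pN x = extend iN pN x.
    by apply: End_ext => m /=; rewrite -iNpN iNK.
  have xf : extend iN pN x * f = extend iN pN x.
    by apply: End_ext => m /=; rewrite -iNpN iNK.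
  (* The quasi-inverse y may lie outside the image of [rho], but d y d does not, and it serves
     equally well because f x f = x for the extended x. *)
  have [y xyx] := Qreg (rho (extend iN pN x)); have [b bE] := Td y.
  exists b; rewrite bE {1}xyx -{1}xf -{2}fx !rhoM fd !mulrA //.
- have fL : extend iL pL 1 = 1 - f by apply: End_ext => m; exact: iLpL.
  have gab : abelian_corner (1 - d).
    move=> k q kk dk kd; apply: dab => //.
      by move: dk; rewrite mulrBl mul1r => /eqP; rewrite subr_eq addrC -subr_eq subrr => /eqP.
    by move: kd; rewrite mulrBr mulr1 => /eqP; rewrite subr_eq addrC -subr_eq subrr => /eqP.
  apply: (abelian_summand_full_exchange rhoB rhoM rho1 rho_unit rho_lift iLK) => [x|]; last first.
    by rewrite fL f'd.
  have gx : (1 - d) * rho (extend iL pL x) = rho (extend iL pL x).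
    rewrite -f'd -rhoM -fL; congr (rho _).
    by apply: End_ext => m /=; rewrite iLK.
  have xg : rho (extend iL pL x) * (1 - d) = rho (extend iL pL x).
    rewrite -f'd -rhoM -fL; congr (rho _).
    by apply: End_ext => m /=; rewrite iLK.
  have gg : (1 - d) * (1 - d) = 1 - d by rewrite -f'd -rhoM f'f'.
  have [|y [[b <-] xbx]] := abelian_corner_quasi_inverse gg gab Qreg unitT gx xg.
    by exists (extend iL pL x).
  by exists b.
Qed.
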